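(* Let $\mathcal{H}$ be a complex separable Hilbert space, and let $p, q, r>0$ be such that $\frac1r=\frac1p+\frac1q$. Then $$\|TS\|'_{r,\infty}\leq \|T\|'_{p,\infty}\,\|S\|'_{q,\infty},\qquad T\in\mathcal{L}_{p,\infty},\ S\in\mathcal{L}_{q,\infty},$$ and the constant (namely $1$) is optimal, that is, it cannot be replaced by any smaller constant.
   Context: For a compact operator $T$ on the complex separable Hilbert space $\mathcal{H}$, let $\{\mu(k,T)\}_{k=0}^\infty$ be the sequence of eigenvalues of $|T|=\sqrt{T^*T}$ arranged in non-increasing order with multiplicities (the singular values of $T$, indexed from $k=0$, extended by zeros if $T$ has finite rank). This sequence is replaced by the function $$\mu(t,T)=\sum_{k=0}^\infty\mu(k,T)\mathbf{1}_{[k,k+1)}(t),\qquad t\geq0.$$ For $0<p<\infty$, the weak Schatten class $\mathcal{L}_{p,\infty}$ is the set of compact operators $T$ on $\mathcal{H}$ with $\sup_{t>0}t^{\frac1p}\mu(t,T)<\infty$. For $T\in\mathcal{L}_{p,\infty}$, the renormalised quantity is $$\|T\|'_{p,\infty}:=\sup_{t>0}\,(pt)^{\frac1p}\mu(t,T)=\sup_{t>0}\,t^{\frac1p}\mu\left(\frac{t}{p},T\right).$$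
   Formalization: The optimality of the constant 1 is claimed only for infinite-dimensional H; on finite-dimensional H a smaller constant suffices (for H = C and p = q = 1 the best constant is 1/4). The inequality is stated for every H. *)

(* Defs.v *)
From HB Require Import structures.
From mathcomp Require Import all_boot all_order all_algebra complex.
From mathcomp Require Import all_classical all_reals all_analysis.
Set Implicit Arguments.
Unset Strict Implicit.
Unset Printing Implicit Defensive.
Import Order.TTheory GRing.Theory Num.Theory.
Import numFieldNormedType.Exports.
Local Open Scope classical_set_scope.
Local Open Scope complex_scope.
Local Open Scope ring_scope.

(* A complex Hilbert space is a complete normed space over R[i] together with
   a form [dot : {dot H for Num.conj}] (positive definite, linear in its first
   argument, conjugate-linear in the second) satisfying [inner_product dot]. *)
Definition inner_product (R : realType) (H : completeNormedModType R[i])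
    (dot : {dot H for @Num.conj R[i]}) : Prop :=
  forall x : H, dot x x = `|x| ^+ 2.

Definition separable (T : topologicalType) : Prop :=
  exists D : set T, countable D /\ dense D.

(* [V] is intended to be a linear subspace; [e] is then a basis of it. *)
Definition has_dim (K : fieldType) (V : lmodType K) (W : set V) (n : nat) :
    Prop :=
  exists e : 'I_n -> V, (forall i, W (e i)) /\
    forall x, W x -> exists! c : 'rV[K]_n, x = \sum_(i < n) c 0 i *: e i.

Definition infinite_dimensional (K : fieldType) (V : lmodType K) : Prop :=
  ~ exists n, has_dim [set: V] n.

Section SingularValues.
Context (R : realType) (H : completeNormedModType R[i]).
Context (dot : {dot H for @Num.conj R[i]}).

Definition compact_operator (T : {linear H -> H}) : Prop :=
  compact (closure (T @` [set x : H | `|x| <= 1])).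

Definition is_adjoint (T T' : {linear H -> H}) : Prop :=
  continuous T' /\ forall x y, dot (T x) y = dot x (T' y).

(* In [R[i]] the inequality [0 <= z] includes that [z] is real. *)
Definition positive_operator (A : {linear H -> H}) : Prop :=
  continuous A /\ forall x, 0 <= dot (A x) x.

(* A = |T|, the positive square root of T^*T. *)
Definition is_modulus (T A : {linear H -> H}) : Prop :=
  positive_operator A /\
  exists T' : {linear H -> H}, is_adjoint T T' /\ A \o A =1 T' \o T.

Definition eigenspace_op (A : {linear H -> H}) (lam : R) : set H :=
  [set x | A x = lam%:C *: x].

(* [mu] lists the eigenvalues of [A] in non-increasing order: each [lam > 0]
   occurs as many times as the dimension of its eigenspace (not at all if it is
   not an eigenvalue).  When there are only finitely many positive eigenvalues
   (with multiplicity) this forces the remaining terms of [mu] to be 0; when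
   there are infinitely many, 0 does not occur. *)
Definition eigenvalue_sequence (A : {linear H -> H}) (mu : nat -> R) : Prop :=
  [/\ nonincreasing_seq mu,
      forall k, 0 <= mu k &
      forall lam, 0 < lam -> exists n,
        has_dim (eigenspace_op A lam) n /\ ([set k | mu k = lam] #= `I_n)%card].

(* mu(k, T).  The sequence exists and is unique for compact [T]; the default
   value is irrelevant for such operators. *)
Definition singular_value (T : {linear H -> H}) : nat -> R :=
  xget (fun=> 0)
    [set mu | exists A, is_modulus T A /\ eigenvalue_sequence A mu].

Definition singular_value_fun (T : {linear H -> H}) (t : R) : R :=
  limn (series (fun k =>
    singular_value T k * \1_(`[k%:R, k.+1%:R[%classic : set R) t)).

Definition weak_schatten (p : R) (T : {linear H -> H}) : Prop :=
  compact_operator T /\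
  (ereal_sup [set (t `^ p^-1 * singular_value_fun T t)%R%:E
             | t in [set t : R | (0 < t)%R]] < +oo)%E.

Definition weak_schatten_norm (p : R) (T : {linear H -> H}) : \bar R :=
  ereal_sup [set ((p * t) `^ p^-1 * singular_value_fun T t)%:E
            | t in [set t : R | 0 < t]].

End SingularValues.

(* Main.v *)
Require Import Defs.
From HB Require Import structures.
From mathcomp Require Import all_boot all_order all_algebra complex.
From mathcomp Require Import all_classical all_reals all_analysis.
From mathcomp Require Import ring lra zify.
Set Implicit Arguments.
Unset Strict Implicit.
Unset Printing Implicit Defensive.
Import Order.TTheory GRing.Theory Num.Theory.
Import numFieldNormedType.Exports.
Local Open Scope classical_set_scope.
Local Open Scope complex_scope.
Local Open Scope ring_scope.

(* For a compact operator [T], successive maximisers of [|T x|] on the unit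
   sphere of [{e_0, .., e_(k-1)}^perp] give a singular value decomposition
   [T x = \sum_k s_k <x, e_k> f_k]; the modulus of [T] is then
   [\sum_k s_k <x, e_k> e_k], and its eigenvalue sequence is [s].  Any other
   modulus [A] satisfies [A^2 = T^* T] and has the same eigenspaces for positive
   eigenvalues, so [mu(k, T) = s_k].

   The variational description of singular values yields
   [mu(n + m, TS) <= mu(n, T) mu(m, S)], hence
   [mu(a + b, TS) <= mu(a, T) mu(b, S)] for real [a, b >= 0], since
   [floor a + floor b <= floor (a + b)].  For [a = u / p] and [b = u / q] one has
   [a + b = u / r], and multiplying by [u^(1/r) = u^(1/p) u^(1/q)] gives the
   inequality with constant 1.

   For optimality, take an orthonormal family [e_0, .., e_N], and let
   [T e_k = (p (k + 1))^(-1/p) e_k] and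
   [S e_k = (q (N + 1 - k))^(-1/q) e_k], which have norm at most 1.  Young's
   inequality bounds every eigenvalue of [TS] from below by
   [(r (N + 2))^(-1/r)], so that the norm of [TS] is at least
   [(N / (N + 2))^(1/r)], which tends to 1. *)

(** * Orthonormal sums in a complex Hilbert space *)

Section HilbertBasics.
Context (R : realType).
Implicit Types V : completeNormedModType R[i].

Lemma complex_ge0_Re (z : R[i]) : 0 <= z -> z = (complex.Re z)%:C.
Proof. by move=> z0; rewrite RRe_real// ger0_real. Qed.

Lemma complex_gt0 (z : R[i]) : 0 < z -> exists2 e : R, 0 < e & z = e%:C.
Proof.
move=> z0; have zE := complex_ge0_Re (ltW z0).
by exists (complex.Re z) => //; rewrite -ltcR -zE.
Qed.

Lemma norm_Re (W : normedZmodType R[i]) (x : W) :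
  `|x| = (complex.Re `|x|)%:C.
Proof. exact: complex_ge0_Re. Qed.

(** The order of [R[i]] is partial, so no argument by trichotomy is available. But [0 <= z] amounts
    to [|z| = z], an equation that passes to limits because the norm is continuous. *)
Lemma cvg_ge0 (K : numFieldType) (u : nat -> K) (l : K) :
  u @ \oo --> l -> (\forall n \near \oo, 0 <= u n) -> 0 <= l.
Proof.
move=> ul u0; suff <- : `|l| = l by [].
apply: (@cvg_unique _ (@norm_hausdorff _ K) (u @ \oo)); last exact: ul.
have : (fun n => `|u n|) @ \oo --> `|l| by apply: cvg_norm.
apply: cvg_trans; apply: near_eq_cvg; near=> n.
by rewrite ger0_norm//; near: n.
Unshelve. all: by end_near. Qed.

Lemma cvg_norm_le (K : numFieldType) (W : normedModType K) (u : nat -> W)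
    (l : W) (c : K) :
  u @ \oo --> l -> (\forall n \near \oo, `|u n| <= c) -> `|l| <= c.
Proof.
move=> ul uc; rewrite -subr_ge0.
apply: (@cvg_ge0 _ (fun n => c - `|u n|)).
  apply: cvgB; first exact: cvg_cst.
  exact: cvg_norm.
by near=> n; rewrite subr_ge0; near: n.
Unshelve. all: by end_near. Qed.

Lemma cvg_epsP (W : normedModType R[i]) (u : nat -> W) (l : W) :
  u @ \oo --> l <->
  forall e : R, 0 < e -> \forall n \near \oo, `|l - u n| < e%:C.
Proof.
split=> [/cvgrPdist_lt ul e e0|ul].
  by apply: ul; rewrite ltcR.
by apply/cvgrPdist_lt => _ /complex_gt0[e e0 ->]; exact: ul.
Qed.

Lemma cauchy_seq_cvg V (u : nat -> V) (k : nat -> R) :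
  (forall e, 0 < e -> exists N, k N < e) ->
  (forall N n, (N <= n)%N -> `|u N - u n| <= (k N)%:C) ->
  exists l : V, u @ \oo --> l.
Proof.
move=> k0 uk; suff : cvg (u @ \oo) by move=> ul; exists (lim (u @ \oo)).
apply/cauchy_cvgP/cauchy_exP => _ /complex_gt0[e e0 ->].
have [N kN] := k0 _ e0; exists (u N); exists N => // n /= Nn.
by rewrite -ball_normE /=; apply: le_lt_trans (uk _ _ Nn) _; rewrite ltcR.
Qed.

Lemma linear_bound_continuous (W W' : normedModType R[i]) (f : {linear W -> W'})
    (M : R) :
  (forall x, `|f x| <= M%:C * `|x|) -> continuous f.
Proof.
move=> fM; apply/linear_bounded_continuous/linear_boundedP.
exists M%:C; split; first by rewrite complex_real.
move=> r Mr x; apply: (le_trans (fM x)); apply: ler_wpM2r => //; exact: ltW.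
Qed.

Lemma linear_cvg (W W' : normedModType R[i]) (f : {linear W -> W'})
    (u : nat -> W) (l : W) :
  continuous f -> u @ \oo --> l -> (fun n => f (u n)) @ \oo --> f l.
Proof. by move=> cf ul; apply: continuous_cvg => //; exact: cf. Qed.

Lemma linear_mk (U W : lmodType R[i]) (f : U -> W) :
  (forall a x y, f (a *: x + y) = a *: f x + f y) ->
  exists F : {linear U -> W}, F =1 f.
Proof.
move=> flin.
pose F : {linear U -> W} := HB.pack f (@GRing.isLinear.Build _ _ _ _ f flin).
by exists F.
Qed.

(** The source of all dimension counts below: the comparison of two bases and the choice of test
    vectors in the min-max argument. *)
Lemma row_kernel (K : fieldType) (m n : nat) (M : 'M[K]_(n, m)) :
  (m < n)%N -> exists2 v : 'rV[K]_n, v != 0 & v *m M = 0.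
Proof.
move=> mn; have : kermx M != 0.
  by rewrite kermx_eq0 /row_free neq_ltn (leq_ltn_trans (rank_leq_col M)).
move=> /rowV0Pn[v vM v0]; exists v => //.
by apply/eqP; rewrite -sub_kermx.
Qed.

Context (H : completeNormedModType R[i]) (dot : {dot H for @Num.conj R[i]}).
Context (hdot : inner_product dot).
Local Notation "'[ u , v ]" := (dot u v) : ring_scope.

Lemma dotC (x y : H) : '[x, y] = ('[y, x])^*.
Proof. by rewrite hermC /= expr0 mul1r. Qed.

Lemma dotZl (a : R[i]) (x y : H) : '[a *: x, y] = a * '[x, y].
Proof. exact: linearZl_LR. Qed.

Lemma dotZr (a : R[i]) (x y : H) : '[x, a *: y] = a^* * '[x, y].
Proof. exact: linearZr_LR. Qed.

Lemma dotDl (x y z : H) : '[x + y, z] = '[x, z] + '[y, z].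
Proof. exact: linearDl. Qed.

Lemma dotBl (x y z : H) : '[x - y, z] = '[x, z] - '[y, z].
Proof. exact: linearBl. Qed.

Lemma dotBr (x y z : H) : '[z, x - y] = '[z, x] - '[z, y].
Proof. exact: linearBr. Qed.

Lemma dot0l (x : H) : '[0, x] = 0. Proof. exact: linear0l. Qed.
Lemma dot0r (x : H) : '[x, 0] = 0. Proof. exact: linear0r. Qed.

Lemma dot_eq0_sym (x y : H) : '[x, y] = 0 -> '[y, x] = 0.
Proof. by move=> xy; rewrite dotC xy conjC0. Qed.

Lemma dot_suml I (r : seq I) (P : pred I) (F : I -> H) (y : H) :
  '[\sum_(i <- r | P i) F i, y] = \sum_(i <- r | P i) '[F i, y].
Proof. exact: linear_sumlz. Qed.

Lemma dot_sumr I (r : seq I) (P : pred I) (F : I -> H) (y : H) :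
  '[y, \sum_(i <- r | P i) F i] = \sum_(i <- r | P i) '[y, F i].
Proof. exact: linear_sumr. Qed.

Lemma sqr_normD_orth (x y : H) :
  '[x, y] = 0 -> `|x + y| ^+ 2 = `|x| ^+ 2 + `|y| ^+ 2.
Proof. by move=> xy; rewrite -!hdot hnormDd. Qed.

Lemma parallelogram (x y : H) :
  `|x + y| ^+ 2 + `|x - y| ^+ 2 = 2 * (`|x| ^+ 2 + `|y| ^+ 2).
Proof. by rewrite -!hdot dnormD dnormB; ring. Qed.

Lemma ler_norm_sqr (x y : R[i]) : 0 <= x -> 0 <= y ->
  x ^+ 2 <= y ^+ 2 -> x <= y.
Proof. by move=> x0 y0; rewrite ler_sqr. Qed.

Lemma cauchy_schwarz (x y : H) : `|'[x, y]| <= `|x| * `|y|.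
Proof.
have [->|y0] := eqVneq y 0; first by rewrite dot0r !normr0 mulr0.
have ny0 : `|y| != 0 by rewrite normr_eq0.
pose a := '[x, y] / `|y| ^+ 2; pose u := x - a *: y.
have uy : '[u, y] = 0.
  by rewrite dotBl dotZl [in X in _ - X]hdot mulfVK ?expf_neq0// subrr.
have xE : x = u + a *: y by rewrite subrK.
have -> : `|'[x, y]| = `|a| * `|y| * `|y|.
  rewrite -mulrA -expr2 normrM normfV [X in _ / X]ger0_norm ?exprn_ge0//.
  by rewrite mulfVK ?expf_neq0.
rewrite ler_wpM2r//; apply: ler_norm_sqr; rewrite ?mulr_ge0//.
rewrite [in leRHS]xE sqr_normD_orth ?dotZr ?uy ?mulr0// [`|a *: y|]normrZ.
by rewrite lerDr exprn_ge0.
Qed.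

Lemma dot_cvgl (u : nat -> H) (l y : H) :
  u @ \oo --> l -> (fun n => '[u n, y] : R[i]^o) @ \oo --> ('[l, y] : R[i]^o).
Proof.
move=> ul; have [F FE] : exists F : {linear H -> R[i]^o}, F =1 (fun x => '[x, y]).
  by apply: linear_mk => a x z; rewrite dotDl dotZl.
rewrite -FE; under eq_fun do rewrite -FE.
apply: linear_cvg ul; apply: (@linear_bound_continuous _ _ _ (complex.Re `|y|)).
by move=> x; rewrite FE mulrC -norm_Re cauchy_schwarz.
Qed.

Lemma dot_cvgr (u : nat -> H) (l y : H) :
  u @ \oo --> l -> (fun n => '[y, u n] : R[i]^o) @ \oo --> ('[y, l] : R[i]^o).
Proof.
move=> /(@dot_cvgl _ _ y) /cvgrPdist_lt ul; apply/cvgrPdist_lt => e /ul.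
apply: filterS => n; rewrite dotC [X in _ - X]dotC -rmorphB.
by rewrite norm_conjC.
Qed.

(** Members may vanish, so that finite families and finite-rank operators are indexed by all of
    [nat]; each ['[u i, u i]] is then 0 or 1. *)
Definition partial_orthonormal (u : nat -> H) :=
  forall i j, '[u i, u j] = ((i == j) && (u i != 0))%:R.

Lemma partial_orthonormal_norm u i : partial_orthonormal u -> u i != 0 ->
  `|u i| = 1.
Proof.
move=> ou ui0; apply/eqP; rewrite -[_ == _](@eqrXn2 _ 2)//.
by rewrite -hdot ou eqxx ui0 expr1n.
Qed.

Lemma partial_orthonormal_dot u i : partial_orthonormal u ->
  '[u i, u i] *: u i = u i.
Proof.
by move=> ou; rewrite ou eqxx; case: eqP => [->|_]; rewrite ?scaler0 ?scale1r.
Qed.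

Section Orthonormal.
Context (u : nat -> H).
Context (ou : partial_orthonormal u).

Lemma dot_sum_orthonormal n (P : pred nat) (a : nat -> R[i]) k :
  '[\sum_(i < n | P i) a i *: u i, u k] =
  if ((k < n)%N && P k) then a k * '[u k, u k] else 0.
Proof.
rewrite dot_suml; case: ifPn => [/andP[kn Pk]|kn].
  rewrite (bigD1 (Ordinal kn))//= dotZl big1 ?addr0// => i /andP[_ ik].
  by rewrite dotZl ou; rewrite -val_eqE /= in ik; rewrite (negbTE ik) mulr0.
rewrite big1// => i Pi; rewrite dotZl ou; case: eqP; rewrite ?mulr0// => ik.
by move: kn; rewrite -ik ltn_ord Pi.
Qed.

Lemma sqr_norm_sum_orthonormal n (P : pred nat) (a : nat -> R[i]) :
  `|\sum_(i < n | P i) a i *: u i| ^+ 2 =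
  \sum_(i < n | P i) `|a i| ^+ 2 * '[u i, u i].
Proof.
rewrite -hdot dot_sumr; apply: eq_bigr => i Pi.
by rewrite dotZr dot_sum_orthonormal ltn_ord Pi /= normCKC mulrA.
Qed.

Lemma partial_orthonormal_dotr x k : '[x, u k] * '[u k, u k] = '[x, u k].
Proof.
by rewrite ou eqxx; case: eqP => [->|_]; rewrite ?dot0r ?mul0r ?mulr1.
Qed.

Lemma dot_projection_residue n (x : H) k : (k < n)%N ->
  '[x - \sum_(i < n) '[x, u i] *: u i, u k] = 0.
Proof.
move=> kn; rewrite dotBl.
rewrite (dot_sum_orthonormal n predT (fun i => '[x, u i])) kn /=.
by rewrite partial_orthonormal_dotr subrr.
Qed.

Lemma bessel n (x : H) : \sum_(i < n) `|'[x, u i]| ^+ 2 <= `|x| ^+ 2.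
Proof.
pose p := \sum_(i < n) '[x, u i] *: u i.
have pE : `|p| ^+ 2 = \sum_(i < n) `|'[x, u i]| ^+ 2.
  rewrite (sqr_norm_sum_orthonormal n predT (fun i => '[x, u i])).
  apply: eq_bigr => i _; rewrite ou eqxx; case: eqP => [->|_].
    by rewrite dot0r normr0 expr0n mul0r.
  by rewrite mulr1.
have xp : '[x - p, p] = 0.
  by rewrite dot_sumr big1// => i _; rewrite dotZr dot_projection_residue ?mulr0.
rewrite -pE -[x in X in _ <= X](subrK p) sqr_normD_orth//.
by rewrite lerDr exprn_ge0.
Qed.

End Orthonormal.
(** Pythagoras for [v], then Bessel for [u]. The predicate [P] lets the same bound serve for full
    partial sums and for their tails. *)
Lemma norm_diag_sum_le (u v : nat -> H) n (P : pred nat) (c : nat -> R[i])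
    (C : R[i]) (x : H) :
  partial_orthonormal u -> partial_orthonormal v -> 0 <= C ->
  (forall i, (i < n)%N -> P i -> `|c i| <= C) ->
  `|\sum_(i < n | P i) (c i * '[x, u i]) *: v i| <= C * `|x|.
Proof.
move=> ou ov C0 cC; apply: ler_norm_sqr; rewrite ?mulr_ge0//.
rewrite (sqr_norm_sum_orthonormal ov n P (fun i => c i * '[x, u i])).
rewrite exprMn; apply: (@le_trans _ _ (C ^+ 2 * \sum_(i < n) `|'[x, u i]| ^+ 2)).
  rewrite mulr_sumr [leRHS](bigID (fun i : 'I_n => P i))/= -[leLHS]addr0.
  apply: lerD; last by apply: sumr_ge0 => i _; rewrite mulr_ge0// exprn_ge0.
  apply: ler_sum => i Pi; rewrite normrM exprMn -[leRHS]mulr1.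
  apply: ler_pM; rewrite ?mulr_ge0 ?exprn_ge0//.
    by rewrite ler_wpM2r ?exprn_ge0// lerXn2r ?nnegrE// cC.
  by rewrite ov; case: (_ && _).
by rewrite ler_wpM2l ?exprn_ge0// bessel.
Qed.

End HilbertBasics.

(** * Compact operators attain their norm *)

Section CompactOperators.
Context (R : realType) (H : completeNormedModType R[i]).
Context (dot : {dot H for @Num.conj R[i]}).
Context (hdot : inner_product dot).
Local Notation "'[ u , v ]" := (dot u v) : ring_scope.
Implicit Types T : {linear H -> H}.

Definition rnorm (x : H) : R := complex.Re `|x|.

Lemma rnormE x : `|x| = (rnorm x)%:C. Proof. exact: norm_Re. Qed.

Lemma rnorm_ge0 x : 0 <= rnorm x.
Proof. by rewrite -ler0c -rnormE. Qed.

Lemma rnormD x y : rnorm (x + y) <= rnorm x + rnorm y.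
Proof. by rewrite -lecR rmorphD /= -!rnormE ler_normD. Qed.

Lemma rnormBC x y : rnorm (x - y) = rnorm (y - x).
Proof. by rewrite /rnorm distrC. Qed.

Lemma rnorm0 : rnorm 0 = 0.
Proof. by rewrite /rnorm normr0. Qed.

Lemma rnorm_eq0 x : (rnorm x == 0) = (x == 0).
Proof. by rewrite -[RHS]normr_eq0 rnormE -(inj_eq (@complexI R)). Qed.

Lemma rnormZ (a : R) x : 0 <= a -> rnorm (a%:C *: x) = a * rnorm x.
Proof.
move=> a0; apply: complexI; rewrite -rnormE normrZ ger0_norm ?ler0c//.
by rewrite rmorphM /= rnormE.
Qed.

Lemma rnorm_parallelogram x y :
  rnorm (x + y) ^+ 2 + rnorm (x - y) ^+ 2 = 2 * (rnorm x ^+ 2 + rnorm y ^+ 2).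
Proof.
apply: complexI.
rewrite rmorphD [RHS]rmorphM rmorph_nat rmorphD !rmorphXn /= -!rnormE.
exact: parallelogram.
Qed.

(** Compactness in the form used below: a cluster point of the images, approached at arbitrarily
    late indices, replaces the extraction of a subsequence. *)
Lemma compact_operator_cluster T (x : nat -> H) :
  compact_operator T -> (forall n, rnorm (x n) <= 1) ->
  exists y, forall e, 0 < e -> forall N : nat,
    exists2 n, (N <= n)%N & rnorm (y - T (x n)) < e.
Proof.
move=> cT x1.
have [|y [_ yx]] := cT ((T \o x) @ \oo).
  exists 0%N => // n _ /=; apply: subset_closure; exists (x n) => //=.
  by rewrite rnormE lecR.
exists y => e e0 N.
have [||z [[n Nn <-] yn]] := yx ((T \o x) @` [set n | (N <= n)%N]) (ball y e%:C).
- by exists N => // n /= Nn; exists n.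
- by apply: nbhsx_ballx; rewrite ltcR.
by exists n => //; move: yn; rewrite -ball_normE /= rnormE ltcR.
Qed.

Lemma compact_operator_bounded T : compact_operator T ->
  exists2 M : R, 0 <= M & forall x, rnorm x <= 1 -> rnorm (T x) <= M.
Proof.
move=> cT; apply: contrapT => nM.
have /choice[x xP] : forall n : nat, exists x,
    rnorm x <= 1 /\ n%:R < rnorm (T x).
  move=> n; apply: contrapT => nx; apply: nM; exists n%:R => // x x1.
  by rewrite leNgt; apply/negP => xn; apply: nx; exists x.
have [y yP] := compact_operator_cluster cT (fun n => (xP n).1).
(* Past this index the images have norm greater than [rnorm y + 1], so none lies within distance 1
   of [y]. *)
pose N := Num.trunc (rnorm y + 1).
have [n Nn yn] := yP 1 ltr01 N.+1.
have yN : rnorm y + 1 < N.+1%:R.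
  have y1 : 0 <= rnorm y + 1 by rewrite addr_ge0// rnorm_ge0.
  by have /andP[] := truncn_itv y1.
have Nn' : N.+1%:R <= n%:R :> R by rewrite ler_nat.
have /ltW := (xP n).2; have := rnormD y (T (x n) - y).
rewrite addrC subrK rnormBC; lra.
Qed.

Lemma rnorm_linear_le T (M : R) (W : set H) :
  (forall a x, W x -> W (a *: x)) -> 0 <= M ->
  (forall x, W x -> rnorm x <= 1 -> rnorm (T x) <= M) ->
  forall x, W x -> rnorm (T x) <= M * rnorm x.
Proof.
move=> WZ M0 TM x Wx; have [->|x0] := eqVneq x 0.
  by rewrite linear0 rnorm0 mulr0.
have nx : 0 < rnorm x by rewrite lt0r rnorm_eq0 x0 rnorm_ge0.
pose y := (rnorm x)^-1%:C *: x.
have xy : x = (rnorm x)%:C *: y.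
  by rewrite scalerA -rmorphM divff ?gt_eqF// scale1r.
have y1 : rnorm y = 1 by rewrite rnormZ ?invr_ge0 ?ltW// mulVf ?gt_eqF.
rewrite [in leLHS]xy linearZ (rnormZ _ (ltW nx)) mulrC ler_wpM2r ?(ltW nx)//.
by apply: TM; rewrite ?y1//; exact: WZ.
Qed.

Lemma compact_operator_le T : compact_operator T ->
  exists2 M : R, 0 <= M & forall x, `|T x| <= M%:C * `|x|.
Proof.
move=> /compact_operator_bounded[M M0 TM]; exists M => // x.
rewrite !rnormE -rmorphM lecR.
by apply: (@rnorm_linear_le T M setT) => // y _; exact: TM.
Qed.

Lemma compact_operator_continuous T : compact_operator T -> continuous T.
Proof. by move=> /compact_operator_le[M M0]; exact: linear_bound_continuous. Qed.

Lemma compact_operator_comp T S : compact_operator T -> compact_operator S ->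
  compact_operator (T \o S).
Proof.
move=> cT cS; have Tc := compact_operator_continuous cT.
(* The image under the continuous [T] of a compact set is compact, hence closed, and it contains the
   image of the unit ball under [T \o S]. *)
have cK : compact (T @` closure (S @` [set x : H | `|x| <= 1])).
  by apply: continuous_compact => //; exact: continuous_subspaceT.
apply: subclosed_compact (cK) _; first exact: closed_closure.
have /closure_id -> := compact_closed (@norm_hausdorff _ H) cK.
apply: closure_subset => _ [x x1 <-]; exists (S x) => //.
by apply: subset_closure; exists x.
Qed.

(* If [M] is the norm of [T] on [W], vectors with [|T z|] near [M] and with
   [T z] near a common point [y] are close to each other, by the parallelogram
   law: so a maximising sequence can be taken to be Cauchy. *)
Lemma norm_attained T (W : set H) : compact_operator T ->
  W 0 -> (forall a x y, W x -> W y -> W (a *: x + y)) ->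
  (forall (u : nat -> H) (l : H), (forall n, W (u n)) -> u @ \oo --> l -> W l) ->
  exists e, [/\ W e, e = 0 \/ (`|e| = 1 /\ T e != 0) &
    forall x, W x -> `|T x| <= `|T e| * `|x|].
Proof.
move=> cT W0 WL Wcl.
have WD x y' : W x -> W y' -> W (x + y').
  by move=> Wx Wy; rewrite -[x]scale1r; exact: WL.
have WZ a x : W x -> W (a *: x) by move=> Wx; rewrite -[_ *: _]addr0; exact: WL.
pose E := [set rnorm (T x) | x in [set x | W x /\ rnorm x <= 1]].
have [B B0 TB] := compact_operator_bounded cT.
have E0 : E 0 by exists 0 => /=; rewrite ?linear0 ?rnorm0.
have supE : has_sup E.
  by split; [exists 0|exists B => _ [x [_ x1] <-]; exact: TB].
pose M := sup E.
have M0 : 0 <= M by exact: (ub_le_sup supE.2 E0).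
have TM x : W x -> rnorm (T x) <= M * rnorm x.
  apply: rnorm_linear_le => //= {}x Wx x1.
  by apply: (ub_le_sup supE.2); exists x.
(* If [T] vanishes on [W] the answer is the vector 0; this is how finite rank produces zero vectors
   in the decomposition. *)
have [M00|Mgt0] := eqVneq M 0.
  exists 0; split=> //; first by left.
  by move=> x /TM; rewrite M00 mul0r linear0 normr0 mul0r rnormE lecR.
have {}Mgt0 : 0 < M by rewrite lt0r Mgt0.
have dgt0 (n : nat) : 0 < n.+1%:R^-1 :> R by [].
have /choice[x xP] : forall n : nat, exists x,
    [/\ W x, rnorm x <= 1 & M - n.+1%:R^-1 < rnorm (T x)].
  by move=> n; have [_ [x [Wx x1] <-] Mx] := sup_adherent (dgt0 n) supE; exists x.
have [y yP] : exists y, forall e, 0 < e -> forall N : nat,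
    exists2 n, (N <= n)%N & rnorm (y - T (x n)) < e.
  by apply: compact_operator_cluster => // n; case: (xP n).
have /choice[z zP] : forall n : nat, exists z, [/\ W z, rnorm z <= 1,
    M - n.+1%:R^-1 < rnorm (T z) & rnorm (y - T z) < n.+1%:R^-1].
  move=> n; have [m nm ym] := yP _ (dgt0 n) n.
  have [Wx x1 Mx] := xP m; exists (x m); split=> //.
  apply: le_lt_trans Mx; rewrite lerB// lef_pV2 ?posrE// ler_nat//.
have [e ze] : exists e : H, z @ \oo --> e.
  apply: (@cauchy_seq_cvg _ _ _ (fun N => Num.sqrt (16 / M * N.+1%:R^-1))).
    move=> a a0; pose N := Num.trunc (16 / M / a ^+ 2); exists N.
    have a20 : 0 < a ^+ 2 by exact: exprn_gt0.
    rewrite -[ltRHS](ger0_norm (ltW a0)) -sqrtr_sqr ltr_sqrt//.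
    rewrite ltr_pdivrMr// [ltRHS]mulrC -ltr_pdivrMr//.
    have : 0 <= 16 / M / a ^+ 2 by rewrite !divr_ge0// ltW.
    by move=> /truncn_itv/andP[].
  move=> N n Nn; have [WN N1 MN yN] := zP N; have [Wn n1 Mn yn] := zP n.
  set d : R := N.+1%:R^-1 in MN yN *.
  have {yn} yn : rnorm (y - T (z n)) < d.
    by apply: lt_le_trans yn _; rewrite lef_pV2 ?posrE// ler_nat.
  have TB' : rnorm (T (z N) - T (z n)) <= 2 * d.
    have := rnormD (T (z N) - y) (y - T (z n)).
    rewrite addrA subrK [X in _ <= X + _]rnormBC; lra.
  have TD : 2 * rnorm (T (z N)) <= M * rnorm (z N + z n) + 2 * d.
    have := rnormD (T (z N) + T (z n)) (T (z N) - T (z n)).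
    rewrite addrACA subrr addr0 -linearD.
    have -> : T (z N) + T (z N) = (2 : R)%:C *: T (z N).
      by rewrite rmorph_nat scaler_nat mulr2n.
    by rewrite rnormZ//; have := TM _ (WD _ _ WN Wn); lra.
  (* [TB'], [TD] and the near-maximality of [z N] give [2 M - 4 d <= M |z N + z n|]; [a] is the loss
     [4 d] divided by [M]. *)
  pose a := 4 * d / M; have aM : M * a = 4 * d by rewrite mulrC divfK ?gt_eqF.
  have ta : 2 - a <= rnorm (z N + z n).
    by rewrite -(ler_pM2l Mgt0); nra.
  rewrite rnormE lecR -[leLHS](ger0_norm (rnorm_ge0 _)) -sqrtr_sqr ler_wsqrtr//.
  have -> : 16 / M * d = 4 * a by rewrite /a; ring.
  have := rnorm_parallelogram (z N) (z n).
  have : rnorm (z N) ^+ 2 <= 1 by rewrite exprn_ile1// rnorm_ge0.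
  have : rnorm (z n) ^+ 2 <= 1 by rewrite exprn_ile1// rnorm_ge0.
  (* With [t = |z N + z n|], this square gives [t^2 >= 4 t - 4 >= 4 - 4 a] whatever the sign of
     [2 - a]; the parallelogram law then leaves [|z N - z n|^2 <= 4 a]. *)
  have := sqr_ge0 (rnorm (z N + z n) - 2).
  nra.
have We : W e by apply: Wcl ze => n; case: (zP n).
have e1 : rnorm e <= 1.
  rewrite -lecR -rnormE; apply: cvg_norm_le ze _.
  by near=> n; rewrite rnormE lecR; case: (zP n).
have MTe : M <= rnorm (T e).
  suff Mle (a : R) : 0 < a -> M <= rnorm (T e) + a by apply/ler_addgt0Pr.
  move=> a0; have a20 : 0 < a / 2 by rewrite divr_gt0.
  have /cvg_epsP/(_ _ a20) Tze :=
    linear_cvg (compact_operator_continuous cT) ze.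
  near \oo => n; have [_ _ Mn _] := zP n.
  have : rnorm (T e - T (z n)) < a / 2 by rewrite -ltcR -rnormE; near: n.
  have : n.+1%:R^-1 < a / 2.
    by near: n; exact: (near_infty_natSinv_lt (PosNum a20)).
  have := rnormD (T e) (T (z n) - T e).
  rewrite addrCA subrr addr0 rnormBC.
  move: Mn; set d : R := n.+1%:R^-1; clearbody d; lra.
have e1' : rnorm e = 1.
  apply/eqP; rewrite eq_le e1 -(ler_pM2l Mgt0) mulr1 (le_trans MTe)//.
  exact: TM.
exists e; split=> //.
  right; split; first by rewrite rnormE e1'.
  by rewrite -rnorm_eq0 gt_eqF// (lt_le_trans Mgt0).
move=> v Wv; rewrite !rnormE -rmorphM lecR (le_trans (TM _ Wv))//.
by rewrite ler_wpM2r// rnorm_ge0.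
Unshelve. all: by end_near. Qed.

End CompactOperators.

(** * Singular value decomposition *)

Section Schmidt.
Context (R : realType) (H : completeNormedModType R[i]).
Context (dot : {dot H for @Num.conj R[i]}).
Context (hdot : inner_product dot).
Local Notation "'[ u , v ]" := (dot u v) : ring_scope.
Implicit Types T : {linear H -> H}.

Definition perp (l : seq H) : set H := [set x | forall y, y \in l -> '[x, y] = 0].

(* [T x = \sum_k s k * '[x, e k] *: f k], where [e k = f k = 0] as soon as
   [s k = 0]. *)
Record schmidt_decomposition T (s : nat -> R) (e f : nat -> H) : Prop := Schmidt {
  schmidt_noninc : nonincreasing_seq s;
  schmidt_ge0 : forall k, 0 <= s k;
  schmidt_orthl : partial_orthonormal dot e;
  schmidt_orthr : partial_orthonormal dot f;
  schmidt_supp : forall k, (e k != 0) = (0 < s k);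
  schmidt_supp_r : forall k, (f k != 0) = (0 < s k);
  schmidt_map : forall k, T (e k) = (s k)%:C *: f k;
  schmidt_dom : forall n x, (forall i, (i < n)%N -> '[x, e i] = 0) ->
    `|T x| <= (s n)%:C * `|x|;
  schmidt_lim : forall eps, 0 < eps -> exists k, s k < eps }.

(** Each vector depends on all the earlier ones, so a maximiser is first chosen on the orthogonal
    complement of every finite list, and the sequence is then built by recursion on lists. *)
Lemma maximizing_sequence T : compact_operator T ->
  exists e : nat -> H, [/\ forall i j, (i < j)%N -> '[e j, e i] = 0,
    forall k, e k = 0 \/ (`|e k| = 1 /\ T (e k) != 0) &
    forall n x, (forall i, (i < n)%N -> '[x, e i] = 0) ->
      `|T x| <= `|T (e n)| * `|x|].
Proof.
move=> cT.
have /choice[st stP] : forall l : seq H, exists e, [/\ perp l e,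
    e = 0 \/ (`|e| = 1 /\ T e != 0) &
    forall x, perp l x -> `|T x| <= `|T e| * `|x|].
  move=> l; apply: (norm_attained hdot cT).
  - by move=> y _; rewrite dot0l.
  - by move=> a x y lx ly z zl; rewrite dotDl dotZl lx// ly// mulr0 addr0.
  - move=> u x lu ux y yl.
    apply: (cvg_unique (@norm_hausdorff _ R[i]^o) (dot_cvgl hdot (y := y) ux)).
    have -> : (fun n => '[u n, y] : R[i]^o) = fun=> 0.
      by apply/funext => n; exact: lu.
    exact: cvg_cst.
(* [es n] lists the first [n] vectors of the sequence, whose term of index [n] is [st (es n)]. *)
pose es := fix es n := if n is m.+1 then rcons (es m) (st (es m)) else [::].
have mem_es n y : reflect (exists2 i, (i < n)%N & y = st (es i)) (y \in es n).
  apply: (iffP idP).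
    elim: n => [//|n IHn] /=; rewrite mem_rcons inE => /predU1P[->|/IHn[i ni ->]].
      by exists n.
    by exists i => //; exact: ltnW.
  move=> [i + ->]; elim: n => [//|n IHn]; rewrite ltnS leq_eqVlt /= mem_rcons inE.
  by case/predU1P => [->|/IHn ->]; rewrite ?eqxx ?orbT.
exists (fun k => st (es k)); split.
- by move=> i j ij; have [+ _ _] := stP (es j); apply; apply/mem_es; exists i.
- by move=> k; have [] := stP (es k).
- move=> n x xn; have [_ _ +] := stP (es n); apply => y /mem_es[i ni ->].
  exact: xn.
Qed.

(* The first variation of [|T x|^2 / |x|^2] vanishes at a maximiser. *)
Lemma maximizer_orthogonal T (M : R[i]) (e y : H) : '[e, y] = 0 ->
  (forall a : R[i], `|T (e + a *: y)| <= M * `|e + a *: y|) ->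
  0 <= M -> `|T e| = M * `|e| -> '[T e, T y] = 0.
Proof.
move=> ey TM M0 Te; set d := '[T e, T y].
pose K := M ^+ 2 * `|y| ^+ 2.
have K0 : 0 <= K by rewrite mulr_ge0// exprn_ge0.
have K1 : 0 < K + 1 by rewrite ltr_wpDl.
apply/eqP; apply: contraT => d0.
have dd : 0 < `|d| ^+ 2 by rewrite exprn_gt0// normr_gt0.
(* With [D = |d|^2], this [a] makes the first-order term [2 D / (K + 1)], while the second-order
   term on the right is [K D / (K + 1)^2], which is too small to dominate it. Using [K + 1] instead
   of [K] keeps the denominator positive. *)
pose a := d / (K + 1).
have aC : a^* = d^* / (K + 1).
  by rewrite rmorphM fmorphV [X in _ / X]geC0_conj// ltW.
have : `|T (e + a *: y)| ^+ 2 <= (M * `|e + a *: y|) ^+ 2.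
  by rewrite lerXn2r ?nnegrE// mulr_ge0.
rewrite exprMn (sqr_normD_orth hdot) ?dotZr ?ey ?mulr0// normrZ exprMn mulrDr.
rewrite linearD linearZ -hdot dnormD !hdot normrZ Te !exprMn dotZr -/d aC.
have aN : `|a| ^+ 2 = `|d| ^+ 2 / (K + 1) ^+ 2.
  by rewrite normrM exprMn normfV exprVn [`|K + 1|]gtr0_norm.
have -> : d^* / (K + 1) * d = `|d| ^+ 2 / (K + 1).
  by rewrite normCK; ring.
rewrite [(_ / _)^*]geC0_conj; last by rewrite divr_ge0// ltW.
rewrite -addrA lerD2l aN.
set D := `|d| ^+ 2 in dd *; move=> h.
have {h} : D / (K + 1) + D / (K + 1) <= K * (D / (K + 1) ^+ 2).
  apply: le_trans (le_trans _ h) _.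
    by rewrite lerDr mulr_ge0 ?exprn_ge0// divr_ge0 ?exprn_ge0// ltW.
  by rewrite le_eqVlt; apply/orP; left; apply/eqP; rewrite /K; ring.
have -> : K * (D / (K + 1) ^+ 2) = D / (K + 1) * (K / (K + 1)).
  by field; rewrite gt_eqF.
rewrite -mulr2n -mulr_natr ler_pM2l ?divr_gt0// ler_pdivlMr// => h.
have : K + 1 <= K.
  apply: le_trans _ h; rewrite mulr_natl mulr2n lerDr; exact: ltW.
by rewrite gerDl ler10.
Qed.

(** The images [T (e k)] are mutually orthogonal by the first variation at the maximisers, so
    normalising them gives [f]. The [s k] become small, since otherwise the [T (e k)] would stay
    uniformly apart, against compactness. *)
Lemma schmidt_exists T : compact_operator T ->
  exists s e f, schmidt_decomposition T s e f.
Proof.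
move=> cT; have [e [orth e01 dom]] := maximizing_sequence cT.
pose s k : R := rnorm (T (e k)).
(* As the inverse of 0 is 0, [f k] vanishes together with [s k]. *)
pose f k := (s k)^-1%:C *: T (e k).
have sE k : `|T (e k)| = (s k)%:C by rewrite rnormE.
have s0 k : 0 <= s k by exact: rnorm_ge0.
have supp k : (e k != 0) = (0 < s k).
  rewrite lt0r s0 andbT rnorm_eq0; case: (e01 k) => [->|[e1 ->]].
    by rewrite linear0 eqxx.
  by rewrite -normr_eq0 e1 oner_eq0.
have e1 k : 0 < s k -> `|e k| = 1.
  by rewrite -supp; case: (e01 k) => [->|[]//]; rewrite eqxx.
have mapf k : T (e k) = (s k)%:C *: f k.
  have [sk|sk] := eqVneq (s k) 0.
    by rewrite sk scale0r; apply/eqP; rewrite -rnorm_eq0 -/(s k) sk.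
  by rewrite scalerA -rmorphM divff// scale1r.
have suppf k : (f k != 0) = (0 < s k).
  rewrite lt0r s0 andbT; congr (~~ _); apply/eqP/eqP => [fk|sk].
    by apply/eqP; rewrite rnorm_eq0 mapf fk scaler0.
  by apply/eqP; rewrite /f sk invr0 scale0r.
have Torth i j : (i < j)%N -> '[T (e i), T (e j)] = 0.
  move=> ij; have [si|si] := eqVneq (s i) 0.
    have -> : T (e i) = 0 by apply/eqP; rewrite -rnorm_eq0 -/(s i) si.
    by rewrite dot0l.
  have {}si : 0 < s i by rewrite lt0r si s0.
  apply: (@maximizer_orthogonal T (s i)%:C).
  - by rewrite (dot_eq0_sym (orth _ _ ij)).
  - move=> a; rewrite -sE; apply: dom => k ki.
    by rewrite dotDl dotZl !orth ?mulr0 ?addr0// (ltn_trans ki).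
  - by rewrite ler0c.
  - by rewrite sE e1// mulr1.
exists s, e, f; split=> //.
- apply/nonincreasing_seqP => k; have [sk|sk] := eqVneq (s k.+1) 0.
    by rewrite sk.
  rewrite -lecR -sE; apply: le_trans (dom k _ _) _.
    by move=> i ik; rewrite orth// ltnW.
  by rewrite e1 ?mulr1 ?sE// lt0r sk s0.
- move=> i j; case: ltngtP => [ij|ij|<-].
  + by rewrite (dot_eq0_sym (orth _ _ ij)).
  + by rewrite orth.
  + rewrite hdot; case: (e01 i) => [->|[ei Tei]].
      by rewrite eqxx normr0 expr0n.
    by rewrite ei expr1n -normr_eq0 ei oner_eq0.
- move=> i j; case: ltngtP => [ij|ij|<-].
  + by rewrite dotZl dotZr Torth ?mulr0.
  + by rewrite dotZl dotZr (dot_eq0_sym (Torth _ _ ij)) ?mulr0.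
  + rewrite hdot suppf normrZ sE ger0_norm ?ler0c ?invr_ge0//.
    rewrite -rmorphM lt0r s0 andbT.
    by have [->|si] := eqVneq (s i) 0; rewrite ?mulr0 ?rmorph0 ?expr0n// mulVf// expr1n.
- by move=> n x xn; rewrite -sE; exact: dom.
- move=> eps eps0; apply: contrapT => ns.
  have se k : eps <= s k by rewrite leNgt; apply/negP => sk; apply: ns; exists k.
  have sgt0 k : 0 < s k by exact: lt_le_trans (se k).
  have [|y yP] := compact_operator_cluster cT (x := e).
    by move=> k; rewrite -lecR -rnormE e1.
  have eps2 : 0 < eps / 2 by rewrite divr_gt0.
  have [n _ yn] := yP _ eps2 0%N; have [m nm ym] := yP _ eps2 n.+1.
  (* By orthogonality two images are at distance at least [s n >= eps], yet both lie within
     [eps / 2] of the cluster point [y]. *)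
  have TT : `|T (e n)| ^+ 2 <= `|T (e n) - T (e m)| ^+ 2.
    rewrite (sqr_normD_orth hdot) ?lerDl ?exprn_ge0//.
    by rewrite -scaleN1r dotZr Torth// mulr0.
  have : s n <= rnorm (T (e n) - T (e m)).
    by rewrite -lecR -sE -rnormE; exact: ler_norm_sqr.
  have := rnormD (T (e n) - y) (y - T (e m)).
  rewrite addrA subrK [rnorm (T (e n) - y)]rnormBC.
  have := se n; lra.
Qed.

End Schmidt.

(** * The singular values are determined by the modulus *)

(** Pigeonhole: if [nu n < mu n], the level-set bijections send the [n + 1] indices [k <= n]
    injectively to indices where [nu] exceeds [nu n], and these are all below [n]. *)
Lemma level_sets_le (R : realType) (mu nu : nat -> R) :
  nonincreasing_seq mu -> nonincreasing_seq nu -> (forall k, 0 <= nu k) ->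
  (forall lam, 0 < lam ->
    ([set k | mu k = lam] #= [set k | nu k = lam])%card) ->
  forall n, mu n <= nu n.
Proof.
move=> mu_ni nu_ni nu0 lev n; rewrite leNgt; apply/negP => nmu.
have mu_gt k : (k <= n)%N -> nu n < mu k.
  by move=> kn; exact: lt_le_trans (mu_ni _ _ kn).
have /choice[phi phiP] : forall lam, exists phi : nat -> nat, 0 < lam ->
    set_bij [set k | mu k = lam] [set k | nu k = lam] phi.
  move=> lam; have [lam0|lam0] := ltP 0 lam; last by exists id.
  by have /card_set_bijP[phi phiP] := lev _ lam0; exists phi.
pose g k := phi (mu k) k.
have gP k : (k <= n)%N -> nu (g k) = mu k.
  move=> kn; have [+ _ _] := phiP _ (le_lt_trans (nu0 n) (mu_gt _ kn)).
  by move=> /(_ k erefl).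
have gn k : (k <= n)%N -> (g k < n)%N.
  move=> kn; rewrite ltnNge; apply/negP => /nu_ni.
  by rewrite gP// leNgt mu_gt.
have ginj j k : (j <= n)%N -> (k <= n)%N -> g j = g k -> j = k.
  move=> jn kn gjk; have mujk : mu j = mu k by rewrite -gP// gjk gP.
  have [_ + _] := phiP _ (le_lt_trans (nu0 n) (mu_gt _ kn)).
  by apply; rewrite ?inE//; move: gjk; rewrite /g mujk.
pose G (i : 'I_n.+1) : 'I_n := Ordinal (gn i (ltn_ord i)).
have : injective G.
  by move=> i j [] gij; apply: val_inj; exact: ginj (ltn_ord i) (ltn_ord j) gij.
by move=> /leq_card; rewrite !card_ord ltnn.
Qed.

(** If [m < n], the [e i], being combinations of [m] vectors, satisfy a nontrivial relation, which
    contradicts the uniqueness of the coordinates of 0. *)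
Lemma has_dim_le (K : fieldType) (V : lmodType K) (W : set V) (n m : nat) :
  W 0 -> has_dim W n -> has_dim W m -> (n <= m)%N.
Proof.
move=> W0 [e [We eP]] [f [Wf fP]]; rewrite leqNgt; apply/negP => mn.
have /choice[a aP] : forall i, exists c : 'rV[K]_m, e i = \sum_(j < m) c 0 j *: f j.
  by move=> i; have [c [cP _]] := fP _ (We i); exists c.
have [v v0 vM] := row_kernel (\matrix_(i, j) a i 0 j) mn.
have v_sum : 0 = \sum_(i < n) v 0 i *: e i.
  under eq_bigr do rewrite aP scaler_sumr.
  rewrite exchange_big big1//= => j _.
  under eq_bigr do rewrite scalerA.
  rewrite -scaler_suml; move/matrixP: vM => /(_ 0 j); rewrite !mxE => vM.
  suff -> : \sum_(i < n) v 0 i * a i 0 j = 0 by rewrite scale0r.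
  by rewrite -[RHS]vM; apply: eq_bigr => i _; rewrite mxE.
have [c [_ cu]] := eP _ W0.
have c0 : c = 0 by apply: cu; rewrite big1// => i _; rewrite mxE scale0r.
by move/cu: v_sum v0; rewrite c0 => <-; rewrite eqxx.
Qed.

(** * Diagonal operators, the modulus and its eigenvalues *)

Section Modulus.
Context (R : realType) (H : completeNormedModType R[i]).
Context (dot : {dot H for @Num.conj R[i]}).
Context (hdot : inner_product dot).
Local Notation "'[ u , v ]" := (dot u v) : ring_scope.
Local Notation partial_orthonormal := (partial_orthonormal dot).
Implicit Types (T A D : {linear H -> H}) (c s : nat -> R) (u v e f : nat -> H).

Definition diag_sum c u v (n : nat) (x : H) : H :=
  \sum_(k < n) ((c k)%:C * '[x, u k]) *: v k.

(** One shape for three operators: from Schmidt data [s, e, f] it gives [T] as [s e f], its adjoint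
    as [s f e] and its modulus as [s e e]. *)
Definition is_diag c u v D := continuous D /\
  forall x, (fun n => diag_sum c u v n x) @ \oo --> D x.

(** The tail of the series from [N] on has norm at most [c N |x|], so partial sums are Cauchy; the
    bound [c 0 |x|] makes the limit continuous. *)
Lemma diag_operator c u v :
  nonincreasing_seq c -> (forall k, 0 <= c k) ->
  (forall eps, 0 < eps -> exists k, c k < eps) ->
  partial_orthonormal u -> partial_orthonormal v ->
  exists D, is_diag c u v D.
Proof.
move=> c_ni c0 clim ou ov.
have /choice[d dP] : forall x, exists l : H,
    (fun n => diag_sum c u v n x) @ \oo --> l.
  move=> x; apply: (@cauchy_seq_cvg _ _ _ (fun N => c N * rnorm x)).
    move=> a a0; have x1 : 0 < rnorm x + 1 by rewrite ltr_wpDl// rnorm_ge0.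
    have [N cN] := clim _ (divr_gt0 a0 x1); exists N.
    move: cN; rewrite ltr_pdivlMr//; apply: le_lt_trans.
    by rewrite ler_wpM2l// lerDl.
  move=> N n Nn; rewrite distrC rmorphM /= -rnormE.
  have -> : diag_sum c u v n x - diag_sum c u v N x =
      \sum_(k < n | (N <= k)%N) ((c k)%:C * '[x, u k]) *: v k.
    rewrite /diag_sum (bigID (fun k : 'I_n => (k < N)%N))/=.
    rewrite (big_ord_widen n (fun k => ((c k)%:C * '[x, u k]) *: v k) Nn).
    by rewrite addrC addrK; apply: eq_bigl => k; rewrite -leqNgt.
  apply: (@norm_diag_sum_le _ _ _ hdot _ _ n (fun k => (N <= k)%N)
    (fun k => (c k)%:C) (c N)%:C x ou ov).
    by rewrite ler0c.
  by move=> k _ Nk; rewrite ger0_norm ?ler0c// lecR c_ni.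
have [D DE] : exists D, D =1 d.
  apply: linear_mk => a x y.
  apply: (cvg_unique (@norm_hausdorff _ H) (dP _)).
  have -> : (fun n => diag_sum c u v n (a *: x + y)) =
      (fun n => a *: diag_sum c u v n x + diag_sum c u v n y).
    apply/funext => n; rewrite /diag_sum scaler_sumr -big_split/=.
    apply: eq_bigr => k _; rewrite scalerA -scalerDl dotDl dotZl.
    by congr (_ *: _); ring.
  by apply: cvgD => //; apply: cvgZr.
exists D; split; last by move=> x; rewrite DE.
apply: (@linear_bound_continuous _ _ _ _ (c 0)) => x; rewrite DE.
apply: cvg_norm_le (dP x) _; apply: nearW => n.
apply: (@norm_diag_sum_le _ _ _ hdot _ _ n predT (fun k => (c k)%:C)
  (c 0)%:C x ou ov).
  by rewrite ler0c.
by move=> k _ _; rewrite ger0_norm ?ler0c// lecR c_ni.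
Qed.

Section Diag.
Context c u v D (ou : partial_orthonormal u) (ov : partial_orthonormal v).
Context (hD : is_diag c u v D).

Lemma is_diag_dot x k : '[D x, v k] = (c k)%:C * '[x, u k] * '[v k, v k].
Proof.
apply: (cvg_unique (@norm_hausdorff _ R[i]^o) (dot_cvgl hdot (y := v k) (hD.2 x))).
apply: cvg_near_cst; exists k.+1 => // n kn /=.
rewrite /diag_sum.
by rewrite (dot_sum_orthonormal ov n predT (fun k => (c k)%:C * '[x, u k])) kn.
Qed.

Lemma is_diag_basis k : D (u k) = ((c k)%:C * '[u k, u k]) *: v k.
Proof.
apply: (cvg_unique (@norm_hausdorff _ H) (hD.2 (u k))).
apply: cvg_near_cst; exists k.+1 => // n /= kn.
rewrite /diag_sum (bigD1 (Ordinal kn))//= big1 ?addr0// => i ik.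
rewrite ou eq_sym; move: ik; rewrite -val_eqE /= => /negbTE ->.
by rewrite mulr0 scale0r.
Qed.

End Diag.

Lemma is_diag_adjoint c u v D D' :
  is_diag c u v D -> is_diag c v u D' -> is_adjoint dot D D'.
Proof.
move=> [cD DP] [cD' D'P]; split=> // x y.
apply: (cvg_unique (@norm_hausdorff _ R[i]^o) (dot_cvgl hdot (y := y) (DP x))).
have := dot_cvgr hdot (y := x) (D'P y).
suff -> : (fun n => '[x, diag_sum c v u n y]) = fun n => '[diag_sum c u v n x, y].
  by [].
apply/funext => n; rewrite dot_suml dot_sumr; apply: eq_bigr => k _.
rewrite dotZl dotZr rmorphM /= ['[v k, y]]dotC.
by rewrite [((c k)%:C)^*]conj_Creal ?complex_real//; ring.
Qed.

Lemma is_diag_positive c u D : (forall k, 0 <= c k) -> is_diag c u u D ->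
  positive_operator dot D.
Proof.
move=> c0 [cD DP]; split=> // x.
apply: cvg_ge0 (dot_cvgl hdot (y := x) (DP x)) _; apply: nearW => n.
rewrite dot_suml; apply: sumr_ge0 => k _.
rewrite dotZl ['[u k, x]]dotC -mulrA -normCK.
by rewrite mulr_ge0 ?exprn_ge0// ler0c.
Qed.

Section SchmidtModulus.
Context T s e f (hT : schmidt_decomposition dot T s e f).
Let oe := schmidt_orthl hT.
Let of_ := schmidt_orthr hT.

(** The partial sum is [T p] for the projection [p] of [x] on the first [n] vectors [e k], and
    [x - p] is orthogonal to these, so the error is at most [s n |x - p| <= 2 s n |x|]. *)
Lemma schmidt_is_diag : continuous T -> is_diag s e f T.
Proof.
move=> cT; split=> // x; apply/cvg_epsP => eps eps0.
have x1 : 0 < 2 * (rnorm x + 1) by rewrite mulr_gt0// ltr_wpDl// rnorm_ge0.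
have [N sN] := schmidt_lim hT (divr_gt0 eps0 x1).
exists N => // n /= Nn; pose p := \sum_(k < n) '[x, e k] *: e k.
have -> : diag_sum s e f n x = T p.
  rewrite /diag_sum linear_sum; apply: eq_bigr => k _.
  by rewrite linearZ /= (schmidt_map hT) scalerA mulrC.
rewrite -linearB; have := schmidt_dom hT (n := n) (x := x - p).
move=> /(_ (dot_projection_residue oe x)) Tp.
apply: le_lt_trans Tp _.
have px : `|p| <= 1 * `|x|.
  rewrite /p; under eq_bigr do rewrite -['[x, _]]mul1r.
  apply: (@norm_diag_sum_le _ _ _ hdot _ _ n predT (fun=> 1) 1 x oe oe) => //.
  by move=> i _ _; rewrite normr1.
have xp : `|x - p| <= (2 * rnorm x)%:C.
  rewrite (le_trans (ler_normB _ _))//.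
  by rewrite mulr_natl mulr2n rmorphD /= -rnormE lerD2l -[leRHS]mul1r.
apply: (@le_lt_trans _ _ ((s n)%:C * (2 * rnorm x)%:C)).
  by rewrite ler_wpM2l// ler0c (schmidt_ge0 hT).
rewrite -rmorphM ltcR; move: sN; rewrite ltr_pdivlMr//; apply: le_lt_trans.
apply: ler_pM; rewrite ?(schmidt_ge0 hT) ?mulr_ge0 ?rnorm_ge0//.
  exact: (schmidt_noninc hT).
by rewrite ler_pM2l// lerDl.
Qed.

Lemma schmidt_dot_supp k : '[f k, f k] = '[e k, e k].
Proof. by rewrite oe of_ (schmidt_supp hT) (schmidt_supp_r hT). Qed.

(** With [A] and [T'] the diagonal operators [s e e] and [s f e], both [A \o A] and [T' \o T]
    multiply [e k] by [s k ^+ 2]. They agree along the partial sums, hence in the limit. *)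
Lemma schmidt_modulus : continuous T ->
  exists A, is_modulus dot T A /\ is_diag s e e A.
Proof.
move=> cT; have Td := schmidt_is_diag cT.
have s_ni := schmidt_noninc hT; have s0 := schmidt_ge0 hT.
have slim := schmidt_lim hT.
have [A dA] := diag_operator s_ni s0 slim oe oe.
have [T' dT'] := diag_operator s_ni s0 slim of_ oe.
exists A; split=> //; split; first exact: is_diag_positive dA.
exists T'; split; first exact: is_diag_adjoint Td dT'.
move=> x /=.
apply: (cvg_unique (@norm_hausdorff _ H) (linear_cvg dA.1 (dA.2 x))).
have := linear_cvg dT'.1 (Td.2 x).
suff -> : (fun n => T' (diag_sum s e f n x)) = (fun n => A (diag_sum s e e n x)).
  by [].
apply/funext => n; rewrite /diag_sum !linear_sum; apply: eq_bigr => k _.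
rewrite !linearZ /= (is_diag_basis of_ dT') (is_diag_basis oe dA).
by rewrite schmidt_dot_supp.
Qed.

(** Since [s] gets below [lam], only finitely many indices [ks] have [s k = lam]. An eigenvector for
    [lam] is orthogonal to every other [e k], so the [e k] with [k] in [ks] form a basis of the
    eigenspace. *)
Lemma schmidt_eigenvalue_sequence A : is_diag s e e A -> eigenvalue_sequence A s.
Proof.
move=> dA; split; [exact: schmidt_noninc hT|exact: schmidt_ge0 hT|].
move=> lam lam0; have [N sN] := schmidt_lim hT lam0.
pose ks := [seq k <- iota 0 N | s k == lam].
have ks_uniq : uniq ks by rewrite filter_uniq// iota_uniq.
have mem_ks k : (k \in ks) = (s k == lam).
  rewrite mem_filter mem_iota add0n; have [sk|//] := eqVneq (s k) lam.
  rewrite ltnNge; apply/negP => /(schmidt_noninc hT).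
  by rewrite sk leNgt sN.
have s_nth i : (i < size ks)%N -> s (nth 0%N ks i) = lam.
  by move=> iks; apply/eqP; rewrite -mem_ks mem_nth.
exists (size ks); split.
  exists (fun i => e (nth 0%N ks i)); split.
    move=> i; rewrite /eigenspace_op /= (is_diag_basis oe dA) -scalerA.
    by rewrite (partial_orthonormal_dot _ oe) s_nth.
  move=> x Ax.
  have x_orth k : s k != lam -> '[x, e k] = 0.
    move=> sk; have := is_diag_dot oe dA x k; rewrite Ax dotZl -mulrA.
    rewrite partial_orthonormal_dotr// => /eqP.
    rewrite -subr_eq0 -mulrBl mulf_eq0.
    rewrite -rmorphB (inj_eq (@complexI R) _ 0) subr_eq0 eq_sym (negbTE sk) /=.
    by move/eqP.
  have xE : x = \sum_(i < size ks) '[x, e (nth 0%N ks i)] *: e (nth 0%N ks i).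
    have lamC : lam%:C != 0 :> R[i] by rewrite (inj_eq (@complexI R) _ 0) gt_eqF.
    apply: (scalerI lamC); rewrite -Ax.
    apply: (cvg_unique (@norm_hausdorff _ H) (dA.2 x)).
    apply: cvg_near_cst; exists N => // n /= Nn.
    rewrite scaler_sumr.
    rewrite -(big_mkord predT
      (fun i => lam%:C *: ('[x, e (nth 0%N ks i)] *: e (nth 0%N ks i)))).
    rewrite -(big_nth 0%N predT (fun k => lam%:C *: ('[x, e k] *: e k))).
    rewrite /diag_sum big_filter.
    rewrite -(big_mkord predT (fun k => ((s k)%:C * '[x, e k]) *: e k)).
    (* The sum is cut at [N]: beyond it [s k < lam] and the terms vanish; before it the terms with
       [s k != lam] vanish by [x_orth]. *)
    rewrite /index_iota subn0 -(subnKC Nn) iotaD big_cat /= add0n addrC.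
    rewrite big1_seq ?add0r.
      rewrite [RHS]big_mkcond; apply: eq_bigr => k _.
      case: eqP => [->|/eqP sk]; first by rewrite scalerA.
      by rewrite (x_orth _ sk) mulr0 scale0r.
    move=> k /andP[_]; rewrite mem_iota => /andP[Nk _].
    rewrite x_orth ?mulr0 ?scale0r// lt_eqF//.
    by rewrite (le_lt_trans _ sN)// (schmidt_noninc hT).
  exists (\row_i '[x, e (nth 0%N ks i)]); split.
    by rewrite [LHS]xE; apply: eq_bigr => i _; rewrite mxE.
  move=> c xc; apply/rowP => i; rewrite mxE [in LHS]xc dot_suml (bigD1 i)//=.
  rewrite dotZl oe eqxx (schmidt_supp hT) s_nth// lam0 mulr1 big1 ?addr0// => j ji.
  rewrite dotZl oe nth_uniq//.
  by rewrite (negbTE ji : (val j == val i) = false) mulr0.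
rewrite card_eq_sym; apply/card_set_bijP; exists (nth 0%N ks); split.
- by move=> i /= iks; rewrite s_nth.
- by move=> i j; rewrite !inE /= => iks jks /eqP; rewrite nth_uniq// => /eqP.
- move=> k /= sk; have kks : k \in ks by rewrite mem_ks sk.
  by exists (index k ks); rewrite /= ?index_mem// nth_index.
Qed.

End SchmidtModulus.

(** For the converse, [y = A x - lam x] satisfies [A y = - lam y], and positivity of [A] forces
    [y = 0]. Positive eigenspaces of a modulus are thus read off its square, that is, off the
    product of the adjoint with [T]. *)
Lemma positive_eigenspace A (lam : R) (x : H) :
  positive_operator dot A -> 0 < lam ->
  A x = lam%:C *: x <-> A (A x) = (lam ^+ 2)%:C *: x.
Proof.
move=> [_ A0] lam0; split=> [Ax|AAx].
  by rewrite Ax linearZ /= Ax scalerA -rmorphM expr2.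
apply/eqP; rewrite -subr_eq0; set y := _ - _.
have Ay : A y = - (lam%:C *: y).
  by rewrite linearB linearZ /= AAx /y scalerBr scalerA -rmorphM -expr2 opprB.
have := A0 y; rewrite Ay -scaleNr dotZl hdot mulNr oppr_ge0 => h.
have : `|y| ^+ 2 <= 0 by rewrite -(@ler_pM2l _ lam%:C) ?mulr0// ltcR.
move=> y2; have : `|y| ^+ 2 == 0 by rewrite eq_le y2 exprn_ge0.
by rewrite expf_eq0 normr_eq0.
Qed.

Lemma adjoint_unique T (T' T'' : {linear H -> H}) :
  is_adjoint dot T T' -> is_adjoint dot T T'' -> T' =1 T''.
Proof.
move=> [_ h'] [_ h''] y; apply/eqP; rewrite -subr_eq0.
suff : `|T' y - T'' y| ^+ 2 == 0 by rewrite expf_eq0 normr_eq0.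
by rewrite -hdot dotBr -h' -h'' subrr.
Qed.

Lemma modulus_eigenspace T A A' (lam : R) : is_modulus dot T A ->
  is_modulus dot T A' -> 0 < lam -> eigenspace_op A lam = eigenspace_op A' lam.
Proof.
move=> [pA [T' [aT' AA]]] [pA' [T'' [aT'' AA']]] lam0.
have AE x : A (A x) = A' (A' x).
  by have /= -> := AA x; have /= -> := AA' x; exact: adjoint_unique aT' aT'' _.
apply/seteqP; split=> x /(positive_eigenspace x _ lam0) Ax.
  by apply/(positive_eigenspace x pA' lam0); rewrite -AE; exact: Ax.
by apply/(positive_eigenspace x pA lam0); rewrite AE; exact: Ax.
Qed.

Lemma eigenvalue_sequence_unique T A A' mu nu :
  is_modulus dot T A -> is_modulus dot T A' ->
  eigenvalue_sequence A mu -> eigenvalue_sequence A' nu -> mu = nu.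
Proof.
move=> TA TA' [mu_ni mu0 muP] [nu_ni nu0 nuP].
have lev lam : 0 < lam -> ([set k | mu k = lam] #= [set k | nu k = lam])%card.
  move=> lam0; have [n [Wn mun]] := muP _ lam0; have [m [Wm num]] := nuP _ lam0.
  rewrite -(modulus_eigenspace TA TA' lam0) in Wm.
  have W0 : eigenspace_op A lam 0 by rewrite /eigenspace_op /= linear0 scaler0.
  suff nm : n = m by rewrite (card_eql mun) nm card_eq_sym.
  by apply/eqP; rewrite eqn_leq !(has_dim_le W0).
apply/funext => n; apply/eqP; rewrite eq_le !level_sets_le// => lam lam0.
by rewrite card_eq_sym lev.
Qed.

Lemma schmidt_singular_value T s e f : continuous T -> schmidt_decomposition dot T s e f ->
  singular_value dot T = s.
Proof.
move=> cT hT; have [A [mA dA]] := schmidt_modulus hT cT.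
have sA := schmidt_eigenvalue_sequence hT dA.
rewrite /singular_value; case: xgetP => [mu _ [A' [mA' muA']]|].
  exact: eigenvalue_sequence_unique mA' mA muA' sA.
by move=> /(_ s) []; exists A.
Qed.

End Modulus.

(** * Variational description and Hoelder inequality *)

Section Minimax.
Context (R : realType) (H : completeNormedModType R[i]).
Context (dot : {dot H for @Num.conj R[i]}).
Context (hdot : inner_product dot).
Local Notation "'[ u , v ]" := (dot u v) : ring_scope.
Local Notation partial_orthonormal := (partial_orthonormal dot).
Local Notation sv := (singular_value dot).
Implicit Types (T S : {linear H -> H}) (e f g : nat -> H).

Lemma singular_value_noninc T : compact_operator T -> nonincreasing_seq (sv T).
Proof.
move=> cT; have [s [e [f hT]]] := schmidt_exists hdot cT.
rewrite (schmidt_singular_value hdot (compact_operator_continuous cT) hT).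
exact: schmidt_noninc hT.
Qed.

Lemma singular_value_ge0 T k : compact_operator T -> 0 <= sv T k.
Proof.
move=> cT; have [s [e [f hT]]] := schmidt_exists hdot cT.
rewrite (schmidt_singular_value hdot (compact_operator_continuous cT) hT).
exact: schmidt_ge0 hT k.
Qed.

Lemma singular_value_upper T n : compact_operator T ->
  exists g, forall x, (forall i, (i < n)%N -> '[x, g i] = 0) ->
    `|T x| <= (sv T n)%:C * `|x|.
Proof.
move=> cT; have [s [e [f hT]]] := schmidt_exists hdot cT.
rewrite (schmidt_singular_value hdot (compact_operator_continuous cT) hT).
by exists e => x; exact: schmidt_dom hT n x.
Qed.

(** On the span of the first [n + 1] Schmidt vectors [T] acts by factors [s i >= s n] onto an
    orthonormal family. Positivity of [sv T n] ensures that these vectors are nonzero. *)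
Lemma singular_value_lower T n : compact_operator T -> 0 < sv T n ->
  exists e, [/\ partial_orthonormal e, forall i, (i <= n)%N -> e i != 0 &
    forall a : nat -> R[i],
      (sv T n)%:C * `|\sum_(i < n.+1) a i *: e i| <=
      `|T (\sum_(i < n.+1) a i *: e i)|].
Proof.
move=> cT; have [s [e [f hT]]] := schmidt_exists hdot cT.
rewrite (schmidt_singular_value hdot (compact_operator_continuous cT) hT) => sn.
have oe := schmidt_orthl hT; have of_ := schmidt_orthr hT.
exists e; split=> // [i ni|a].
  by rewrite (schmidt_supp hT) (lt_le_trans sn)// (schmidt_noninc hT).
apply: ler_norm_sqr; rewrite ?mulr_ge0 ?ler0c ?(ltW sn)//.
rewrite exprMn linear_sum /=.
under [in leRHS]eq_bigr do rewrite linearZ /= (schmidt_map hT) scalerA.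
rewrite (sqr_norm_sum_orthonormal hdot of_ n.+1 predT (fun i => a i * (s i)%:C)).
rewrite (sqr_norm_sum_orthonormal hdot oe n.+1 predT a) mulr_sumr.
apply: ler_sum => i _; rewrite (schmidt_dot_supp hT) mulrA.
rewrite ler_wpM2r// normrM exprMn mulrC ler_wpM2l ?exprn_ge0//.
rewrite [`|_%:C|]ger0_norm ?ler0c ?(schmidt_ge0 hT)//.
rewrite lerXn2r ?nnegrE ?ler0c ?(schmidt_ge0 hT)// lecR.
by apply: (schmidt_noninc hT); rewrite -ltnS.
Qed.

(** There are [n + 1] unknowns and [n] linear conditions. The resulting vector meets both a lower
    bound on the span of [e] and an upper bound on the complement of [g], which is the comparison
    behind both min-max estimates below. *)
Lemma orthogonal_combination (e g : nat -> H) n : partial_orthonormal e ->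
  (forall i, (i <= n)%N -> e i != 0) ->
  exists2 a : nat -> R[i], \sum_(i < n.+1) a i *: e i != 0 &
    forall j, (j < n)%N -> '[\sum_(i < n.+1) a i *: e i, g j] = 0.
Proof.
move=> oe e0.
have [v v0 vM] := row_kernel (\matrix_(i < n.+1, j < n) '[e i, g j]) (ltnSn n).
pose a k := v 0 (inord k); exists a => [|j jn].
  apply: contraNneq v0 => x0; apply/eqP/rowP => i; rewrite mxE.
  have : '[\sum_(k < n.+1) a k *: e k, e i] = 0 by rewrite x0 dot0l.
  rewrite (dot_sum_orthonormal oe n.+1 predT a) ltn_ord /= oe eqxx e0 -1?ltnS//.
  by rewrite mulr1 /a inord_val.
rewrite dot_suml; move/rowP: vM => /(_ (Ordinal jn)); rewrite !mxE => vM.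
rewrite -[RHS]vM; apply: eq_bigr => i _.
by rewrite dotZl /a inord_val mxE.
Qed.

Lemma singular_value_le T (c : R) g n : compact_operator T -> 0 <= c ->
  (forall x, (forall i, (i < n)%N -> '[x, g i] = 0) -> `|T x| <= c%:C * `|x|) ->
  sv T n <= c.
Proof.
move=> cT c0 Tg; have [//|svn] := leP (sv T n) c.
have [e [oe e0 Te]] := singular_value_lower cT (le_lt_trans c0 svn).
have [a x0 xg] := orthogonal_combination g oe e0.
by have := le_trans (Te a) (Tg _ xg); rewrite ler_pM2r ?normr_gt0// lecR leNgt svn.
Qed.

Lemma singular_value_ge T (c : R) e n : compact_operator T ->
  partial_orthonormal e -> (forall i, (i <= n)%N -> e i != 0) ->
  (forall a : nat -> R[i], c%:C * `|\sum_(i < n.+1) a i *: e i| <=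
    `|T (\sum_(i < n.+1) a i *: e i)|) ->
  c <= sv T n.
Proof.
move=> cT oe e0 Te; have [g Tg] := singular_value_upper n cT.
have [a x0 xg] := orthogonal_combination g oe e0.
by have := le_trans (Te a) (Tg _ xg); rewrite ler_pM2r ?normr_gt0// lecR.
Qed.

Lemma compact_operator_adjoint T : compact_operator T ->
  exists T', is_adjoint dot T T'.
Proof.
move=> cT; have [s [e [f hT]]] := schmidt_exists hdot cT.
have [A [[_ [T' [aT' _]]] _]] :=
  schmidt_modulus hdot hT (compact_operator_continuous cT).
by exists T'.
Qed.

(** Imposing [m] conditions on [x] bounds [S x], and [n] conditions on [S x] bound [T (S x)]; the
    latter become conditions on [x] through the adjoint [S']. This makes [n + m] conditions in
    all. *)
Lemma singular_value_comp T S n m : compact_operator T -> compact_operator S ->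
  sv (T \o S) (n + m) <= sv T n * sv S m.
Proof.
move=> cT cS; have [S' [_ SS']] := compact_operator_adjoint cS.
have [f Tf] := singular_value_upper n cT; have [g Sg] := singular_value_upper m cS.
pose h k := if (k < m)%N then g k else S' (f (k - m)%N).
apply: (singular_value_le (g := h)).
- exact: compact_operator_comp.
- by rewrite mulr_ge0// singular_value_ge0.
move=> x xh; rewrite rmorphM /= -mulrA.
have Sx : `|S x| <= (sv S m)%:C * `|x|.
  by apply: Sg => i im; have := xh i; rewrite /h im; apply; exact: ltn_addl.
have TSx : `|T (S x)| <= (sv T n)%:C * `|S x|.
  apply: Tf => i ni; have := xh (m + i)%N.
  rewrite /h ifN -?leqNgt ?leq_addr// addKn -SS'; apply.
  by rewrite addnC ltn_add2r.
apply: le_trans TSx _; rewrite ler_wpM2l// ler0c singular_value_ge0//.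
Qed.

Lemma singular_value_funE T (t : R) : 0 <= t ->
  singular_value_fun dot T t = sv T (Num.trunc t).
Proof.
move=> t0; apply: (cvg_lim (@norm_hausdorff _ R)); apply: cvg_near_cst.
exists (Num.trunc t).+1 => // n /= tn.
rewrite /series /= big_mkord (bigD1 (Ordinal tn))//= big1 ?addr0.
  by rewrite indicE mem_set ?mulr1//= in_itv /= truncn_itv.
move=> i ti; rewrite indicE memNset ?mulr0//= in_itv /= -truncn_eq//.
by rewrite eq_sym; apply/negP; move: ti; rewrite -val_eqE.
Qed.

Lemma weak_schatten_norm_ub T (p t : R) : 0 < t ->
  (((p * t) `^ p^-1 * sv T (Num.trunc t))%:E <= weak_schatten_norm dot p T)%E.
Proof.
move=> t0; apply: ereal_sup_ubound; exists t => //=.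
by rewrite singular_value_funE// (ltW t0).
Qed.

Lemma weak_schatten_norm_ge0 T (p : R) : compact_operator T ->
  (0 <= weak_schatten_norm dot p T)%E.
Proof.
move=> cT; apply: le_trans (weak_schatten_norm_ub T p ltr01).
by rewrite lee_fin mulr_ge0 ?powR_ge0 ?singular_value_ge0.
Qed.

Lemma weak_schatten_norm_comp T S (p q r : R) :
  0 < p -> 0 < q -> 0 < r -> r^-1 = p^-1 + q^-1 ->
  compact_operator T -> compact_operator S ->
  (weak_schatten_norm dot r (T \o S) <=
    weak_schatten_norm dot p T * weak_schatten_norm dot q S)%E.
Proof.
move=> p0 q0 r0 pqr cT cS; apply: ge_ereal_sup => _ [t /= t0 <-].
have u0 : 0 < r * t by rewrite mulr_gt0.
set u := r * t in u0 *; pose a := u / p; pose b := u / q.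
have a0 : 0 < a by rewrite divr_gt0.
have b0 : 0 < b by rewrite divr_gt0.
have tab : t = a + b.
  by rewrite /a /b -mulrDr -pqr /u mulrAC divff ?mul1r// gt_eqF.
have ta := weak_schatten_norm_ub T p a0; have tb := weak_schatten_norm_ub S q b0.
have pa : p * a = u by rewrite mulrC divfK ?gt_eqF.
have qb : q * b = u by rewrite mulrC divfK ?gt_eqF.
rewrite pa in ta; rewrite qb in tb.
apply: le_trans (lee_pmul _ _ ta tb); last 2 first.
- by rewrite lee_fin mulr_ge0 ?powR_ge0 ?singular_value_ge0.
- by rewrite lee_fin mulr_ge0 ?powR_ge0 ?singular_value_ge0.
rewrite -EFinM lee_fin singular_value_funE ?(ltW t0)// mulrACA.
rewrite -powRD; last by rewrite (gt_eqF u0) implybT.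
rewrite -pqr ler_wpM2l ?powR_ge0//.
apply: le_trans _ (singular_value_comp _ _ cT cS).
apply: singular_value_noninc; first exact: compact_operator_comp.
rewrite truncn_ge_nat ?(ltW t0)// natrD tab.
by rewrite lerD// truncn_le ltW.
Qed.

End Minimax.

(** * Optimality of the constant *)

(** After raising to the power [r], this is Young's inequality with the conjugate exponents [p / r]
    and [q / r]. *)
Lemma weighted_powR_le (R : realType) (p q r x y : R) :
  0 < p -> 0 < q -> 0 < r -> r^-1 = p^-1 + q^-1 -> 0 <= x -> 0 <= y ->
  (p * x) `^ p^-1 * (q * y) `^ q^-1 <= (r * (x + y)) `^ r^-1.
Proof.
move=> p0 q0 r0 pqr x0 y0.
have px0 : 0 <= p * x by rewrite mulr_ge0// ltW.
have qy0 : 0 <= q * y by rewrite mulr_ge0// ltW.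
have scale z s : 0 < s -> z `^ s^-1 = (z `^ (r / s)) `^ r^-1.
  by move=> s0; rewrite -powRrM mulrAC divff ?mul1r// gt_eqF.
rewrite (scale _ p)// (scale (q * y) q)// -powRM ?powR_ge0//.
apply: ge0_ler_powR; rewrite ?nnegrE ?mulr_ge0 ?powR_ge0 ?invr_ge0 ?addr_ge0 ?(ltW r0)//.
have unscale z s : 0 <= z -> 0 < s -> (z `^ (r / s)) `^ (s / r) = z.
  move=> z0 s0; rewrite -powRrM.
  have -> : r / s * (s / r) = 1 by field; rewrite !gt_eqF.
  by rewrite powRr1.
(* The right side becomes [(r / p) (p x) + (r / q) (q y) = r (x + y)]. *)
have := @conjugate_powR R ((p * x) `^ (r / p)) ((q * y) `^ (r / q)) (p / r) (q / r).
move=> /(_ (powR_ge0 _ _) (powR_ge0 _ _) (divr_gt0 p0 r0) (divr_gt0 q0 r0)).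
rewrite !invf_div -mulrDr -pqr divff ?gt_eqF// => /(_ erefl).
rewrite !unscale//; move/le_trans; apply.
rewrite le_eqVlt; apply/orP; left; apply/eqP; field.
by rewrite !gt_eqF.
Qed.

Section Optimality.
Context (R : realType) (H : completeNormedModType R[i]).
Context (dot : {dot H for @Num.conj R[i]}).
Context (hdot : inner_product dot).
Local Notation "'[ u , v ]" := (dot u v) : ring_scope.
Local Notation partial_orthonormal := (partial_orthonormal dot).
Local Notation sv := (singular_value dot).
Implicit Types (T S D : {linear H -> H}) (e u v : nat -> H) (c : nat -> R).

(** A Gram-Schmidt step: if every [x] equalled its projection on the first [N] vectors, these would
    be a basis of [H]. *)
Lemma orthonormal_family N : infinite_dimensional H ->
  exists e, partial_orthonormal e /\ forall i, (e i != 0) = (i < N)%N.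
Proof.
move=> infH; elim: N => [|N [e [oe e0]]].
  by exists (fun=> 0); split=> [i j|i]; rewrite ?dot0l eqxx ?andbF.
have [x xe] : exists x : H, x != \sum_(i < N) '[x, e i] *: e i.
  apply: contrapT => nx; apply: infH; exists N, (fun i => e i); split=> // x _.
  exists (\row_i '[x, e i]); split.
    apply: contrapT => xE; apply: nx; exists x; apply/eqP => xE'; apply: xE.
    by rewrite [LHS]xE'; apply: eq_bigr => i _; rewrite mxE.
  move=> a xa; apply/rowP => i; rewrite mxE [in LHS]xa dot_suml (bigD1 i)//=.
  rewrite dotZl oe eqxx e0 ltn_ord mulr1 big1 ?addr0// => j ji.
  by rewrite dotZl oe (negbTE ji : (val j == val i) = false) mulr0.
pose y := x - \sum_(i < N) '[x, e i] *: e i.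
have y0 : `|y| != 0 by rewrite normr_eq0 subr_eq0.
have ye i : '[y, e i] = 0.
  have [iN|iN] := boolP (i < N)%N; first exact: dot_projection_residue.
  by rewrite -e0 negbK in iN; rewrite (eqP iN) dot0r.
pose z := `|y|^-1 *: y.
have z1 : '[z, z] = 1 by rewrite hdot normrZ normfV normr_id mulVf// expr1n.
have z0 : z != 0 by rewrite scaler_eq0 negb_or invr_eq0 y0 -normr_eq0.
have ze i : '[z, e i] = 0 by rewrite dotZl ye mulr0.
exists (fun i => if i == N then z else e i); split=> [i j|i]; last first.
  case: (eqVneq i N) => [->|iN]; first by rewrite z0 ltnSn.
  by rewrite e0 ltnS [RHS]leq_eqVlt (negbTE iN).
case: (eqVneq i N) => [->|iN].
  case: (eqVneq j N) => [_|jN]; first by rewrite z1 z0.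
  by rewrite ze.
case: (eqVneq j N) => [->|jN]; last by rewrite oe.
by rewrite (dot_eq0_sym (ze i)) (negbTE iN).
Qed.

(** By induction, one more complex coefficient contributes its real and imaginary parts, each in the
    compact segment [[-M, M]]; the new set is a continuous image of a product of compact sets. *)
Lemma compact_finite_combinations n (M : R) v : exists2 K : set H, compact K &
  forall z : nat -> R[i], (forall k, (k < n)%N -> `|z k| <= M%:C) ->
    K (\sum_(k < n) z k *: v k).
Proof.
elim: n => [|n [K cK KP]].
  by exists [set 0]; [exact: compact_set1|move=> z _; rewrite big_ord0].
have scale_cont (w : H) : continuous (fun t : R => t%:C *: w).
  move=> t; apply/cvgrPdist_lt => _ /complex_gt0[eps eps0 ->].
  have w1 : 0 < rnorm w + 1 by rewrite ltr_wpDl// rnorm_ge0.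
  near=> s; rewrite -scalerBl -rmorphB normrZ rnormE.
  rewrite normc_def /= expr0n addr0 sqrtr_sqr -rmorphM ltcR.
  apply: (@le_lt_trans _ _ (`|t - s| * (rnorm w + 1))).
    by rewrite ler_wpM2l// lerDl.
  rewrite -ltr_pdivlMr//; near: s; apply: cvgr_dist_lt; first exact: cvg_id.
  exact: divr_gt0.
pose F (t : H * (R * R)) : H :=
  t.1 + (t.2.1%:C *: v n + t.2.2%:C *: ('i *: v n)).
have cF : continuous F.
  move=> [a [b d]]; apply: cvgD; first exact: cvg_fst.
  apply: cvgD.
    apply: (continuous_cvg _ (@scale_cont (v n) b)).
    by apply: (@cvg_comp _ _ _ snd fst); [exact: cvg_snd|exact: cvg_fst].
  apply: (continuous_cvg _ (@scale_cont ('i *: v n) d)).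
  by apply: (@cvg_comp _ _ _ snd snd); [exact: cvg_snd|exact: cvg_snd].
exists (F @` (K `*` (`[- M, M] `*` `[- M, M]))).
  apply: continuous_compact; first exact: continuous_subspaceT.
  by apply: compact_setX => //; apply: compact_setX; exact: segment_compact.
move=> z zM; rewrite big_ord_recr /=.
exists (\sum_(k < n) z k *: v k, (complex.Re (z n), complex.Im (z n))) => /=.
  split; first by apply: KP => k kn; apply: zM; exact: ltnW.
  have := zM n (ltnSn n); rewrite normc_def lecR => zn.
  have M0 : 0 <= M by apply: le_trans zn; exact: sqrtr_ge0.
  split => /=; rewrite in_itv /= -ler_norml -sqrtr_sqr; apply: le_trans zn;
    by rewrite ler_wsqrtr// ?lerDl ?lerDr sqr_ge0.
by rewrite /F /= scalerA -scalerDl [in RHS](complexE (z n)) mulrC.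
Unshelve. all: by end_near. Qed.

Lemma finite_diag_compact c u v D N : partial_orthonormal u ->
  (forall k, 0 <= c k) -> nonincreasing_seq c ->
  (forall k, (N <= k)%N -> c k = 0) -> is_diag dot c u v D -> compact_operator D.
Proof.
move=> ou c0 c_ni cN dD; have [K cK KP] := compact_finite_combinations N (c 0) v.
apply: subclosed_compact (cK) _; first exact: closed_closure.
have /closure_id -> := compact_closed (@norm_hausdorff _ H) cK.
apply: closure_subset => _ [x /= x1 <-].
have -> : D x = \sum_(k < N) ((c k)%:C * '[x, u k]) *: v k.
  apply: (cvg_unique (@norm_hausdorff _ H) (dD.2 x)); apply: cvg_near_cst.
  exists N => // n /= Nn; rewrite /diag_sum.
  rewrite (big_ord_widen n (fun k => ((c k)%:C * '[x, u k]) *: v k) Nn).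
  rewrite [RHS]big_mkcond; apply: eq_bigr => k _; case: ltnP => // kN.
  by rewrite cN// mul0r scale0r.
apply: (KP (fun k => (c k)%:C * '[x, u k])) => k kN.
rewrite normrM ger0_norm ?ler0c// -[leRHS]mulr1.
apply: ler_pM => //; [by rewrite ler0c|by rewrite lecR c_ni|].
apply: le_trans (cauchy_schwarz hdot _ _) _.
rewrite -[leRHS]mulr1 ler_pM//; have [->|uk0] := eqVneq (u k) 0.
  by rewrite normr0.
by rewrite (partial_orthonormal_norm hdot ou).
Qed.

(** Vectors orthogonal to the first [k] of the [u i] only meet coefficients [c i <= c k], so [u]
    itself serves as the test family. *)
Lemma diag_singular_value_le c u v D k :
  partial_orthonormal u -> partial_orthonormal v -> nonincreasing_seq c ->
  (forall k, 0 <= c k) -> is_diag dot c u v D -> compact_operator D ->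
  sv D k <= c k.
Proof.
move=> ou ov c_ni c0 dD cD; apply: (singular_value_le hdot (g := u)) => // x xu.
apply: cvg_norm_le (dD.2 x) _; apply: nearW => n.
have -> : diag_sum dot c u v n x =
    \sum_(i < n | (k <= i)%N) ((c i)%:C * '[x, u i]) *: v i.
  rewrite [RHS]big_mkcond; apply: eq_bigr => i _; case: leqP => // ik.
  by rewrite xu// mulr0 scale0r.
apply: (@norm_diag_sum_le _ _ _ hdot _ _ n (fun i => (k <= i)%N)
  (fun i => (c i)%:C) (c k)%:C x ou ov).
  by rewrite ler0c.
by move=> i _ ki; rewrite ger0_norm ?ler0c// lecR c_ni.
Qed.

(* The largest singular values that an operator of rank [N] with weak norm at
   most 1 can have. *)
Definition extremal_sequence (N : nat) (p : R) (k : nat) : R :=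
  if (k < N)%N then ((p * k.+1%:R) `^ p^-1)^-1 else 0.

Lemma extremal_sequence_ge0 N p k : 0 <= extremal_sequence N p k.
Proof. by rewrite /extremal_sequence; case: ifP => // _; rewrite invr_ge0 powR_ge0. Qed.

Lemma extremal_sequence_noninc N p : 0 < p ->
  nonincreasing_seq (extremal_sequence N p).
Proof.
move=> p0 i j ij; rewrite /extremal_sequence; case: (ltnP j N) => jN; last first.
  by rewrite -/(extremal_sequence N p i) extremal_sequence_ge0.
rewrite (leq_ltn_trans ij jN) lef_pV2 ?posrE ?powR_gt0 ?mulr_gt0//.
by rewrite ge0_ler_powR ?nnegrE ?invr_ge0 ?mulr_ge0 ?(ltW p0)// ler_pM2l// ler_nat.
Qed.

Lemma extremal_operator N p u : 0 < p -> partial_orthonormal u ->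
  exists D, [/\ is_diag dot (extremal_sequence N p) u u D,
    weak_schatten dot p D & (weak_schatten_norm dot p D <= 1)%E].
Proof.
move=> p0 ou; set c := extremal_sequence N p.
have c0 k : 0 <= c k by exact: extremal_sequence_ge0.
have c_ni : nonincreasing_seq c by exact: extremal_sequence_noninc.
have cN k : (N <= k)%N -> c k = 0 by rewrite /c /extremal_sequence ltnNge => ->.
have [D dD] : exists D, is_diag dot c u u D.
  by apply: diag_operator => // eps eps0; exists N; rewrite cN.
have cD := finite_diag_compact ou c0 c_ni cN dD.
(* The entry of index [Num.trunc t] is built from [Num.trunc t + 1], which exceeds [t]. *)
have bound (t : R) : 0 < t -> (p * t) `^ p^-1 * sv D (Num.trunc t) <= 1.
  move=> t0; have := diag_singular_value_le (Num.trunc t) ou ou c_ni c0 dD cD.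
  move=> /(ler_wpM2l (powR_ge0 (p * t) p^-1))/le_trans; apply.
  rewrite /c /extremal_sequence; case: ifP => _; last by rewrite mulr0.
  have pt : 0 < p * (Num.trunc t).+1%:R by rewrite mulr_gt0.
  rewrite ler_pdivrMr ?powR_gt0// mul1r ge0_ler_powR ?nnegrE ?invr_ge0 ?mulr_ge0
    ?(ltW p0) ?(ltW t0)//.
  by rewrite ler_pM2l//; have /andP[_ /ltW] := truncn_itv (ltW t0).
exists D; split=> //; last first.
  apply: ge_ereal_sup => _ [t /= t0 <-]; rewrite lee_fin.
  by rewrite singular_value_funE ?(ltW t0)// bound.
(* Without the factor [p] under the power, the bound 1 is divided by [p^(1/p)]. *)
split=> //; apply: (@le_lt_trans _ _ ((p `^ p^-1)^-1)%:E); last exact: ltry.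
apply: ge_ereal_sup => _ [t /= t0 <-]; rewrite lee_fin.
rewrite singular_value_funE ?(ltW t0)// -[leRHS]mulr1.
rewrite ler_pdivlMl ?powR_gt0// mulrA -powRM ?(ltW p0) ?(ltW t0)//.
exact: bound.
Qed.

End Optimality.

(** * Oppositely ordered diagonal operators and the limit of large rank *)

Section OptimalConstant.
Context (R : realType) (H : completeNormedModType R[i]).
Context (dot : {dot H for @Num.conj R[i]}).
Context (hdot : inner_product dot).
Local Notation "'[ u , v ]" := (dot u v) : ring_scope.
Local Notation partial_orthonormal := (partial_orthonormal dot).
Local Notation sv := (singular_value dot).

Lemma reverse_partial_orthonormal N (e : nat -> H) : partial_orthonormal e ->
  partial_orthonormal (fun k => if (k < N)%N then e (N.-1 - k)%N else 0).
Proof.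
move=> oe i j; case: ifPn => iN; last by rewrite dot0l eqxx andbF.
case: ifPn => jN; last first.
  by rewrite dot0r; case: eqVneq jN => [<-|//]; rewrite iN.
rewrite oe; congr ((_ && _)%:R); apply/eqP/eqP => [|->//]; lia.
Qed.

(* The large singular values of [T] and of [S] sit on opposite ends of the same
   orthonormal family, so that [T \o S] is nearly a multiple of the identity on
   its span. *)
Lemma near_extremal_pair (p q r : R) N : infinite_dimensional H ->
  0 < p -> 0 < q -> 0 < r -> r^-1 = p^-1 + q^-1 ->
  exists T S : {linear H -> H},
    [/\ weak_schatten dot p T /\ (weak_schatten_norm dot p T <= 1)%E,
        weak_schatten dot q S /\ (weak_schatten_norm dot q S <= 1)%E &
        ((r * N.+2%:R) `^ r^-1)^-1 <= sv (T \o S) N].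
Proof.
move=> infH p0 q0 r0 pqr; have [e [oe e0]] := orthonormal_family hdot N.+1 infH.
have oe' := reverse_partial_orthonormal N.+1 oe.
have [T [dT wT nT]] := extremal_operator hdot N.+1 p0 oe.
have [S [dS wS nS]] := extremal_operator hdot N.+1 q0 oe'.
exists T, S; split=> //.
pose g k : R := extremal_sequence N.+1 p k * extremal_sequence N.+1 q (N - k).
(* [e k] is the vector of index [N - k] in the reversed family along which [S] is diagonal. *)
have TSe k : (k < N.+1)%N -> T (S (e k)) = (g k)%:C *: e k.
  move=> kN; have := is_diag_basis oe' dS (N - k).
  rewrite ltnS leq_subr /= subKn// => ->.
  rewrite oe eqxx e0 kN mulr1 linearZ /= (is_diag_basis oe dT).
  by rewrite oe eqxx e0 kN mulr1 scalerA -rmorphM mulrC.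
have g_ge k : (k < N.+1)%N -> ((r * N.+2%:R) `^ r^-1)^-1 <= g k.
  move=> kN; rewrite /g /extremal_sequence kN ltnS leq_subr -invfM.
  have x0 (t : R) j : 0 < t -> 0 < t * j.+1%:R by move=> t0; rewrite mulr_gt0.
  rewrite lef_pV2 ?posrE ?mulr_gt0 ?powR_gt0 ?x0//.
  (* The weights [k + 1] and [N - k + 1] add up to [N + 2] for every [k], so the bound is uniform in
     [k]. *)
  apply: le_trans (weighted_powR_le p0 q0 r0 pqr (ler0n _ _) (ler0n _ _)) _.
  rewrite -natrD; have -> // : (k.+1 + (N - k).+1 = N.+2)%N by lia.
apply: (singular_value_ge hdot (e := e)) => // [|i iN|a].
- by apply: compact_operator_comp; [case: wT|case: wS].
- by rewrite e0 ltnS.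
have C0 : 0 <= ((r * N.+2%:R) `^ r^-1)^-1 by rewrite invr_ge0 powR_ge0.
apply: ler_norm_sqr; rewrite ?mulr_ge0 ?ler0c//.
rewrite exprMn /= !linear_sum /=.
have -> : \sum_(i < N.+1) T (S (a i *: e i)) =
    \sum_(i < N.+1) (a i * (g i)%:C) *: e i.
  by apply: eq_bigr => i _; rewrite !linearZ /= TSe// scalerA.
rewrite (sqr_norm_sum_orthonormal hdot oe N.+1 predT (fun i => a i * (g i)%:C)).
rewrite (sqr_norm_sum_orthonormal hdot oe N.+1 predT a) mulr_sumr.
apply: ler_sum => i _; rewrite mulrA ler_wpM2r// normrM exprMn mulrC.
have gi := g_ge _ (ltn_ord i).
rewrite ler_wpM2l ?exprn_ge0// [`|_%:C|]ger0_norm ?ler0c ?(le_trans C0)//.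
by rewrite lerXn2r ?nnegrE ?ler0c ?(le_trans C0)// lecR.
Qed.

Lemma constant_ge1 (r c : R) : 0 < r -> 0 <= c ->
  (forall N : nat, (N.+1%:R / N.+3%:R) `^ r^-1 <= c) -> 1 <= c.
Proof.
move=> r0 c0 cN; rewrite leNgt; apply/negP => c1.
have cr1 : c `^ r < 1.
  have -> : 1 = 1 `^ r :> R by rewrite powR1.
  by rewrite gt0_ltr_powR ?nnegrE.
have d0 : 0 < 1 - c `^ r by rewrite subr_gt0.
(* With [d = c^r < 1] and [n = N + 1], the inequality [n <= d (n + 2)] would give
   [n (1 - d) <= 2 d < 2], whereas this choice makes [n (1 - d) > 2]. *)
pose N := Num.trunc (2 / (1 - c `^ r)).
have N2 : 2 / (1 - c `^ r) < N.+1%:R.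
  have d2 : 0 <= 2 / (1 - c `^ r) by rewrite divr_ge0// ltW.
  by have /andP[] := truncn_itv d2.
have x0 : 0 <= N.+1%:R / N.+3%:R :> R by rewrite divr_ge0.
have : N.+1%:R / N.+3%:R <= c `^ r.
  have -> : N.+1%:R / N.+3%:R = ((N.+1%:R / N.+3%:R) `^ r^-1) `^ r.
    by rewrite -powRrM mulVf ?gt_eqF// powRr1.
  by apply: ge0_ler_powR; rewrite ?nnegrE ?powR_ge0 ?(ltW r0).
rewrite ler_pdivrMr//; move: N2; rewrite ltr_pdivrMr//.
have -> : N.+3%:R = N.+1%:R + 2 :> R by rewrite -natrD addn2.
set n : R := N.+1%:R; set d : R := c `^ r in d0 *.
nra.
Qed.

Lemma optimal_constant (p q r c : R) : infinite_dimensional H ->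
  0 < p -> 0 < q -> 0 < r -> r^-1 = p^-1 + q^-1 ->
  (forall T S : {linear H -> H},
     weak_schatten dot p T -> weak_schatten dot q S ->
     (weak_schatten_norm dot r (T \o S) <=
      c%:E * (weak_schatten_norm dot p T * weak_schatten_norm dot q S))%E) ->
  1 <= c.
Proof.
move=> infH p0 q0 r0 pqr hc.
have step N : 0 <= c /\ (N.+1%:R / N.+3%:R) `^ r^-1 <= c.
  have [T [S [[wT nT] [wS nS] svTS]]] := near_extremal_pair N.+1 infH p0 q0 r0 pqr.
  have := hc T S wT wS.
  (* The supremum is tested at [t = N + 1], whose truncation is the last index of the family of
     [N + 2] vectors. *)
  have := weak_schatten_norm_ub dot (T \o S) r (ltr0Sn R N).
  rewrite natrK => lb /(le_trans lb).
  have T0 := weak_schatten_norm_ge0 hdot p wT.1.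
  have S0 := weak_schatten_norm_ge0 hdot q wS.1.
  have Tfin : weak_schatten_norm dot p T \is a fin_num.
    by rewrite ge0_fin_numE// (le_lt_trans nT)// ltry.
  have Sfin : weak_schatten_norm dot q S \is a fin_num.
    by rewrite ge0_fin_numE// (le_lt_trans nS)// ltry.
  move: T0 S0 nT nS; rewrite -(fineK Tfin) -(fineK Sfin) !lee_fin.
  move: (fine _) (fine _) => y x x0 y0 x1 y1.
  have : (N.+1%:R / N.+3%:R) `^ r^-1 <= (r * N.+1%:R) `^ r^-1 * sv (T \o S) N.+1.
    apply: le_trans (ler_wpM2l (powR_ge0 _ _) svTS).
    have -> : r * N.+1%:R = N.+1%:R / N.+3%:R * (r * N.+3%:R) :> R.
      by field.
    rewrite (@powRM _ (N.+1%:R / N.+3%:R)) ?divr_ge0 ?mulr_ge0 ?(ltW r0)//.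
    rewrite mulfK// gt_eqF// powR_gt0//.
    by rewrite mulr_gt0.
  have : 0 < (N.+1%:R / N.+3%:R) `^ r^-1 :> R by rewrite powR_gt0// divr_gt0.
  set K := _ * sv _ _; set G := _ `^ _ => G0 GK.
  move=> Kc.
  have xy0 : 0 <= x * y by rewrite mulr_ge0.
  have xy1 : x * y <= 1 by rewrite mulr_ile1.
  (* A negative [c] would make the right side nonpositive, against the positive lower bound [G]; the
     sign is needed before [x * y <= 1] can be used. *)
  have c0 : 0 <= c.
    rewrite leNgt; apply/negP => c0.
    have := le_trans GK Kc; have := mulr_le0_ge0 (ltW c0) xy0; lra.
  by split=> //; rewrite (le_trans GK)// (le_trans Kc)// ler_piMr.
have c0 := (step 0%N).1.
by apply: (constant_ge1 r0 c0) => N; have [] := step N.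
Qed.

End OptimalConstant.

(** Infinite dimension matters for optimality: on a one-dimensional space the smaller constant
    [r^(1/r) p^(-1/p) q^(-1/q) < 1] suffices. *)
Theorem theorem1p4 (R : realType) (H : completeNormedModType R[i])
    (dot : {dot H for @Num.conj R[i]})
    (hdot : inner_product dot) (hsep : separable H)
    (p q r : R) (hp : 0 < p) (hq : 0 < q) (hr : 0 < r)
    (hpqr : r^-1 = p^-1 + q^-1) :
  (forall T S : {linear H -> H},
     weak_schatten dot p T -> weak_schatten dot q S ->
     (weak_schatten_norm dot r (T \o S) <=
      weak_schatten_norm dot p T * weak_schatten_norm dot q S)%E)
  /\
  (infinite_dimensional H ->
   forall c : R,
     (forall T S : {linear H -> H},
        weak_schatten dot p T -> weak_schatten dot q S ->
        (weak_schatten_norm dot r (T \o S) <=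
         c%:E * (weak_schatten_norm dot p T * weak_schatten_norm dot q S))%E) ->
     1 <= c).
Proof.
split=> [T S [cT _] [cS _]|infH c]; first exact: weak_schatten_norm_comp.
exact: optimal_constant.
Qed.
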